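(* Let $\beta_0=\alpha$ and $\nu=\varepsilon/\mu$. There exist $C_U,K_1,K_2>0$, independent of $\beta$, $\nu$, $m$ and $i$, such that for all $\beta\in(0,\beta_0)$ and $i,m\in\mathbb N_0$ $$\|(\widetilde{\mathbf U}_i^L)^{(m)}\|_{0,\beta}\le C_U(\beta_0-\beta)^{-(2i+1+m)}(i+m)^iK_1^iK_2^m\nu^{-m}.$$
   Context: $I=(0,1)$; $0<\varepsilon\le\mu\le1$; $\nu:=\varepsilon/\mu$, $\mathbf E:=\mathrm{diag}(\nu^2,1)$. Fixed real data: $\mathbf F=(f,g)^T$ and $\mathbf A(x)=(a_{ij}(x))_{i,j=1,2}$ with $f,g,a_{ij}$ analytic on $[0,1]$: for some constants $C_f,\gamma_f,C_g,\gamma_g,C_a,\gamma_a>0$ and all $n\in\mathbb N_0$, $\|f^{(n)}\|_{L^\infty(I)}\le C_f\gamma_f^n n!$, $\|g^{(n)}\|_{L^\infty(I)}\le C_g\gamma_g^n n!$, $\|a_{ij}^{(n)}\|_{L^\infty(I)}\le C_a\gamma_a^n n!$. For some fixed $\alpha>0$, $\xi^T\mathbf A(x)\xi\ge\alpha^2\xi^T\xi$ for all $\xi\in\mathbb R^2$, $x\in[0,1]$. Conventions: functions with negative subscript are zero; $0^0=1$; $\mathbf A_k:=\frac1{k!}\mathbf A^{(k)}(0)$; $\mathbf F_0=(f,g)^T$, $\mathbf F_i=0$ for $i>0$. Outer functions on $[0,1]$: $\mathbf A(x)\mathbf U_i=\mathbf F_i+\mathbf E\,\mathbf U_{i-2}''$,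 $i\in\mathbb N_0$. Inner functions on $(0,\infty)$: $\widetilde{\mathbf U}_i^L$ solves $-\mathbf E(\widetilde{\mathbf U}_i^L)''+\mathbf A(0)\widetilde{\mathbf U}_i^L=-\sum_{n=0}^{i-1}\widetilde x^{\,i-n}\mathbf A_{i-n}\widetilde{\mathbf U}_n^L$, $\widetilde{\mathbf U}_i^L(0)=-\mathbf U_i(0)$, $\widetilde{\mathbf U}_i^L(\widetilde x)\to0$ as $\widetilde x\to\infty$. Norm: $\|\mathbf u\|_{0,\beta}^2:=\int_0^\infty e^{2\beta x}|\mathbf u(x)|^2dx$. *)

(* Defs.v *)
From HB Require Import structures.
From mathcomp Require Export all_boot all_order all_algebra.
From mathcomp Require Export all_classical all_reals all_analysis.
Export Order.TTheory GRing.Theory Num.Theory.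
Export numFieldNormedType.Exports.

Set Implicit Arguments.
Unset Strict Implicit.
Unset Printing Implicit Defensive.

Local Open Scope classical_set_scope.
Local Open Scope ring_scope.

Section DerivativeWithin.
Context {R : realType} {V : normedModType R}.

Definition diff_quotient (f : R -> V) (x y : R) : V :=
  (y - x)^-1 *: (f y - f x).

(* Derivative relative to D: at an endpoint of an interval this is the
   one-sided derivative, and the values of f outside D play no role. *)
Definition derivable_within (D : set R) (f : R -> V) (x : R) : Prop :=
  cvg (diff_quotient f x y @[y --> within D x^']).

Definition derive_within (D : set R) (f : R -> V) (x : R) : V :=
  lim (diff_quotient f x y @[y --> within D x^']).

Definition deriven_within (D : set R) (n : nat) (f : R -> V) : R -> V :=
  iter n (derive_within D) f.

End DerivativeWithin.

Section Data.
Context {R : realType}.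

Definition I01 : set R := [set` `[0%R, 1%R]].

Definition Linfty_norm01 (f : R -> R) : \bar R :=
  Lnorm (@lebesgue_measure R) +oo%E (EFin \o (f \_ `]0, 1[)).

Definition analytic01 (C gamma : R) (f : R -> R) : Prop :=
  forall n : nat,
    (forall x : R, 0 <= x <= 1 ->
       derivable_within I01 (deriven_within I01 n f) x) /\
    (Linfty_norm01 (deriven_within I01 n f)
       <= (C * gamma ^+ n * n`!%:R)%:E)%E.

Definition Emx (nu : R) : 'M[R]_2 :=
  diag_mx (\row_(j < 2) (if j == 0 then nu ^+ 2 else 1)).

Definition Frhs (f g : R -> R) (i : nat) (x : R) : 'cV[R]_2 :=
  if i is 0%N then \col_(j < 2) (if j == 0 then f x else g x) else 0.

Definition Acoef (A : R -> 'M[R]_2) (k : nat) : 'M[R]_2 :=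
  (k`!%:R)^-1 *: deriven_within I01 k A 0.

(* U_{i-2}, with the convention that negative subscripts give 0. *)
Definition lag2 (U : nat -> R -> 'cV[R]_2) (i : nat) : R -> 'cV[R]_2 :=
  if i is j.+2 then U j else fun=> 0.

Definition is_outer (nu : R) (f g : R -> R) (A : R -> 'M[R]_2)
    (U : nat -> R -> 'cV[R]_2) : Prop :=
  forall (i : nat) (x : R), 0 <= x <= 1 ->
    [/\ derivable_within I01 (U i) x,
        derivable_within I01 (derive_within I01 (U i)) x &
        A x *m U i x =
          Frhs f g i x + Emx nu *m deriven_within I01 2 (lag2 U i) x].

Definition is_inner (nu : R) (A : R -> 'M[R]_2)
    (U W : nat -> R -> 'cV[R]_2) : Prop :=
  forall i : nat,
    [/\ forall x : R, 0 < x ->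
          [/\ derivable (W i) x 1, derivable (derive1 (W i)) x 1 &
              - (Emx nu *m derive1n 2 (W i) x) + A 0 *m W i x =
                - \sum_(n < i) x ^+ (i - n) *: (Acoef A (i - n) *m W n x)],
        W i x @[x --> 0^'+] --> W i 0,
        W i 0 = - U i 0 &
        W i x @[x --> +oo] --> (0 : 'cV[R]_2)].

Definition sqr_euclid (v : 'cV[R]_2) : R := \sum_(j < 2) v j 0 ^+ 2.

(* Valued in [0, +oo]: a finite bound on it includes integrability. *)
Definition norm0 (beta : R) (u : R -> 'cV[R]_2) : \bar R :=
  ((\int[@lebesgue_measure R]_(x in `]0%R, +oo[)
      (expR (2 * beta * x) * sqr_euclid (u x))%:E) `^ (2^-1))%E.

End Data.

(* Main.v *)
Require Import Defs.
From mathcomp Require Import ring lra zify ess_sup_inf measurable_realfun.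

(** The inner problem of order [i] has constant coefficients, so everything
rests on one a priori estimate for [- E V'' + A(0) V = F], [V(0) = V(oo) = 0]:
with [D = alpha - beta],
<<
  |V|_beta <= 2 M / (alpha D),     |V'|_beta <= M / (nu D)
>>
whenever both components of [F] have weighted norm at most [M]
([energy_bound]). It comes from [Q = (V . E V) / 2]. Multiplying the equation
by [exp (2 beta x) V] and using coercivity, [nu <= 1] and Young's inequality
bounds a weighted sum of [|V|^2] and [V' . E V'] by
[(exp (2 beta x) Q')' + exp (2 beta x) |F|^2 / (2 alpha D)]
([energy_pointwise]). The behaviour of [V'] near 0 and at infinity is unknown
beforehand; but since [Q >= 0] tends to 0 at both ends of the half-line, the mean
value theorem gives points arbitrarily close to 0 where [Q' >= 0] and points
arbitrarily far away where [Q' <= 0], so the boundary terms of the integrated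
inequality have the right sign along a sequence of intervals exhausting the
half-line ([int_pos_le_primitive]).

The boundary value [- U_i(0)] is removed by adding [U_i(0) exp (- 2 alpha x)],
so its size must be controlled, which is a matter of Taylor coefficients at 0.
The outer functions are smooth because [A(x)] is invertible, and with
[u_{i,n}] the [n]-th Taylor coefficient of [U_i] the outer equations read
<<
  A_0 u_{i,n} = F_{i,n} + (n+1)(n+2) E u_{i-2,n+2} - sum_{k=1..n} A_k u_{i,n-k},
>>
whence [|u_{i,n}| <= C K^i L^n (n+i)!/n!] by induction ([outer_recursion]), and
[|U_i(0)| <= C K^i i^i] ([outer_at0_bound]).

The theorem then follows by induction on [i], and on [m] for fixed [i]
([inner_bound]). The forcing contains [x^k W_n] with [k = i - n]; the factor
[x^k] is absorbed by passing from [beta] to [beta + kappa D], which costs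
[(k / (kappa D))^k]. With [kappa] proportional to [k / (i + m)] this cost is
[(i + m)^k D^(-k)] up to a factor [c^k], and the deterioration of the bound for
[W_n], where the distance to [alpha] has shrunk to [(1 - kappa) D], is another
factor of the form [c^k] ([shift_power], [wnorm_pow_deriv]). The factors [c^k] are summed by taking [K1]
large ([wnorm_forcing]). The cases [m = 0] and [m = 1] are the energy estimate
([energy_step]); a higher derivative is expressed by the differentiated
equation through the derivative two orders lower, at the cost [nu^(-2)]
([inner_derivSS]). *)

Set Implicit Arguments.
Unset Strict Implicit.
Unset Printing Implicit Defensive.

Local Open Scope classical_set_scope.
Local Open Scope ring_scope.

(** * Derivatives relative to a set *)

Section DerivativeOnSet.
Context {R : realType}.
Implicit Types (D : set R) (f g : R -> R) (x : R) (n : nat).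

(** Stating this as a relation avoids any choice of derivative where the limit
does not exist, and one theory then serves both [[0, 1]] with its one-sided
derivatives and the open half-line. *)
Definition deriv_on D f g :=
  forall x, D x -> diff_quotient f x y @[y --> within D x^'] --> g x.

#[local] Instance within_dnbhs_filter D x : Filter (within D x^').
Proof. exact: within_filter. Qed.

(** This makes derivatives relative to [D] unique. *)
Definition perfect_set D := forall x, D x -> ProperFilter (within D x^').

Fixpoint diff_class D n f : Prop :=
  if n is p.+1 then exists2 g, deriv_on D f g & diff_class D p g else True.

Definition smooth_on D f := forall n, diff_class D n f.

Lemma near_within_mem D x (P : R -> Prop) :
  (forall y, D y -> y != x -> P y) -> \forall y \near within D x^', P y.
Proof.
move=> H; rewrite /within /= near_withinE; near=> y => Dy.
apply: H => //; near: y; exact: nbhs_dnbhs_neq.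
Unshelve. all: by end_near. Qed.

Lemma cvg_within_eq D x (h k : R -> R) (l : R) :
  (forall y, D y -> y != x -> h y = k y) ->
  h y @[y --> within D x^'] --> l -> k y @[y --> within D x^'] --> l.
Proof.
by move=> hk; apply: cvg_trans; apply: near_eq_cvg; exact: near_within_mem.
Qed.

Lemma deriv_on_ext D f f' g g' : {in D, f =1 f'} -> {in D, g =1 g'} ->
  deriv_on D f g -> deriv_on D f' g'.
Proof.
move=> ff gg H x Dx; rewrite -gg ?inE//.
apply: cvg_trans (H x Dx); apply: near_eq_cvg.
apply: near_within_mem => y Dy _.
by rewrite /diff_quotient !ff ?inE.
Qed.

(** As for ordinary derivatives,
[f y = f x + (y - x) * diff_quotient f x y]. *)
Lemma deriv_on_cvg D f g x : deriv_on D f g -> D x ->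
  f y @[y --> within D x^'] --> f x.
Proof.
move=> H Dx.
have Hy : y @[y --> within D x^'] --> x.
  move=> P /nbhs_dnbhs; exact: cvg_within.
have Hid : (y - x) @[y --> within D x^'] --> (0 : R).
  by rewrite -(subrr x); apply: (cvgB Hy); exact: cvg_cst.
have : ((y - x) * diff_quotient f x y + f x) @[y --> within D x^'] --> 0 * g x + f x.
  apply: cvgD; last exact: cvg_cst.
  by apply: (cvgM Hid); exact: H.
rewrite mul0r add0r; apply: cvg_trans; apply: near_eq_cvg.
apply: near_within_mem => y Dy yx /=.
rewrite /diff_quotient /GRing.scale /=.
by rewrite mulVKf ?subr_eq0// subrK.
Qed.

Lemma deriv_on_cst D (c : R) : deriv_on D (cst c) (cst 0).
Proof.
move=> x Dx; apply: (@cvg_within_eq _ _ (cst 0)); last exact: cvg_cst.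
by move=> y _ _; rewrite /diff_quotient /= subrr scaler0.
Qed.

Lemma deriv_on_id D : deriv_on D id (cst 1).
Proof.
move=> x Dx; apply: (@cvg_within_eq _ _ (cst 1)); last exact: cvg_cst.
move=> y _ yx; by rewrite /diff_quotient /GRing.scale /= mulVf// subr_eq0.
Qed.

Lemma deriv_onD D f f' g g' : deriv_on D f f' -> deriv_on D g g' ->
  deriv_on D (f \+ g) (f' \+ g').
Proof.
move=> Hf Hg x Dx /=.
apply: (@cvg_within_eq _ _
  (fun y => diff_quotient f x y + diff_quotient g x y)); last first.
  by apply: cvgD; [exact: Hf|exact: Hg].
by move=> y _ yx; rewrite /diff_quotient /GRing.scale /=; ring.
Qed.

Lemma deriv_onM D f f' g g' : deriv_on D f f' -> deriv_on D g g' ->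
  deriv_on D (f \* g) (fun x => f' x * g x + f x * g' x).
Proof.
move=> Hf Hg x Dx /=.
apply: (@cvg_within_eq _ _
  (fun y => diff_quotient f x y * g y + f x * diff_quotient g x y)); last first.
  apply: cvgD; apply: cvgM; [exact: Hf|exact: deriv_on_cvg Hg Dx| |exact: Hg].
  exact: cvg_cst.
by move=> y _ yx; rewrite /diff_quotient /GRing.scale /=; ring.
Qed.

Lemma deriv_onV D f f' : (forall x, D x -> f x != 0) -> deriv_on D f f' ->
  deriv_on D (fun x => (f x)^-1) (fun x => - f' x * ((f x)^-1 * (f x)^-1)).
Proof.
move=> f0 Hf x Dx /=.
apply: (@cvg_within_eq _ _
  (fun y => - diff_quotient f x y * ((f y)^-1 * (f x)^-1))); last first.
  apply: cvgM; first by apply: cvgN; exact: Hf.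
  apply: cvgM; last exact: cvg_cst.
  by apply: cvgV; [exact: f0|exact: deriv_on_cvg Hf Dx].
move=> y Dy yx; rewrite /diff_quotient /GRing.scale /=.
have ? : y - x != 0 by rewrite subr_eq0.
by field; rewrite !f0.
Qed.

Lemma diff_class_ext D n f f' : {in D, f =1 f'} ->
  diff_class D n f -> diff_class D n f'.
Proof.
case: n => [//|n] ff [g Hg Hn]; exists g => //; exact: deriv_on_ext Hg.
Qed.

Lemma diff_classS D n f : diff_class D n.+1 f -> diff_class D n f.
Proof.
elim: n f => [//|n IH] f [g Hg Hn]; exists g => //; exact: IH.
Qed.

Lemma diff_class_cst D n (c : R) : diff_class D n (cst c).
Proof. elim: n c => [//|n IH] c; exists (cst 0) => //; exact: deriv_on_cst. Qed.

Lemma diff_class_id D n : diff_class D n id.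
Proof.
case: n => [//|n]; exists (cst 1); first exact: deriv_on_id.
exact: diff_class_cst.
Qed.

Lemma diff_classD D n f g : diff_class D n f -> diff_class D n g ->
  diff_class D n (f \+ g).
Proof.
elim: n f g => [//|n IH] f g [f' Hf Hf'] [g' Hg Hg'].
exists (f' \+ g'); first exact: deriv_onD.
exact: IH.
Qed.

(** Both terms of the product rule are products of functions that are
one order smoother than required. *)
Lemma diff_classM D n f g : diff_class D n f -> diff_class D n g ->
  diff_class D n (f \* g).
Proof.
elim: n f g => [//|n IH] f g /[dup] /diff_classS Sf [f' Hf Hf']
  /[dup] /diff_classS Sg [g' Hg Hg'].
exists ((f' \* g) \+ (f \* g')); first exact: deriv_onM.
by apply: diff_classD; apply: IH.
Qed.

(** The derivative [- f' * (1/f) * (1/f)] involves [1/f] itself, which is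
already known to be of the lower class. *)
Lemma diff_classV D n f : (forall x, D x -> f x != 0) ->
  diff_class D n f -> diff_class D n (fun x => (f x)^-1).
Proof.
move=> f0; elim: n => [//|n IH] /[dup] /diff_classS /IH Sf [f' Hf Hf'].
exists (((cst (-1)) \* f') \* ((fun x => (f x)^-1) \* (fun x => (f x)^-1))).
  move=> x Dx /=; rewrite mulN1r; exact: (deriv_onV f0 Hf Dx).
by do !apply: diff_classM => //; exact: diff_class_cst.
Qed.

Section Perfect.
Variable D : set R.
Hypothesis pD : perfect_set D.

Lemma deriv_on_derive f g x : deriv_on D f g -> D x -> derive_within D f x = g x.
Proof.
move=> H Dx; have ? := pD Dx.
by apply: cvg_lim => //; exact: H.
Qed.

Lemma diff_class_derive n f : diff_class D n.+1 f ->
  deriv_on D f (derive_within D f) /\ diff_class D n (derive_within D f).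
Proof.
move=> [g Hg Hn]; split.
  by apply: (deriv_on_ext _ _ Hg) => // x /set_mem Dx; rewrite (deriv_on_derive Hg).
by apply: diff_class_ext Hn => x /set_mem Dx; rewrite (deriv_on_derive Hg).
Qed.

Lemma smooth_on_deriven f n : smooth_on D f -> smooth_on D (deriven_within D n f).
Proof.
move=> sf; elim: n => [//|n IH] k /=; by case: (diff_class_derive (IH k.+1)).
Qed.

Lemma smooth_on_deriv_on f n : smooth_on D f ->
  deriv_on D (deriven_within D n f) (deriven_within D n.+1 f).
Proof.
by move=> sf; case: (diff_class_derive (smooth_on_deriven n sf 1)).
Qed.

(** Iterated derivatives relative to [D] only see the values on [D]. *)
Lemma deriven_within_ext n f f' : {in D, f =1 f'} ->
  {in D, deriven_within D n f =1 deriven_within D n f'}.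
Proof.
move=> ff; elim: n => [//|n IH] x /set_mem Dx /=.
rewrite /derive_within.
have E : forall h h' : R -> R, {in D, h =1 h'} -> 
   diff_quotient h x y @[y --> within D x^'] `=>` diff_quotient h' x y @[y --> within D x^'].
  move=> h h' hh; apply: near_eq_cvg; apply: near_within_mem => y Dy _.
  by rewrite /diff_quotient !hh ?inE.
congr lim; apply/seteqP; split => P; apply: E => // z zD; by rewrite IH.
Qed.

Lemma derivable_smooth_on f :
  (forall n x, D x -> derivable_within D (deriven_within D n f) x) ->
  smooth_on D f.
Proof.
move=> H; suff : forall n m, diff_class D n (deriven_within D m f) by move=> /(_ _ 0%N).
elim=> [//|n IH] m; exists (deriven_within D m.+1 f) => // x Dx.
have := H m x Dx; exact.
Qed.

End Perfect.
End DerivativeOnSet.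

(** * The unit interval, the half-line and matrix entries *)

Section Concrete.
Context {R : realType}.
Implicit Types (f g : R -> R) (x : R).

Lemma perfect_I01 : perfect_set (@I01 R).
Proof.
move=> x; rewrite /I01 /= in_itv /= => /andP[x0 x1].
apply: Build_ProperFilter => [].
rewrite /within /= => -[e /= e0 H].
pose d := Num.min (e / 2) (1 / 2) : R.
have d0 : 0 < d by rewrite lt_min !divr_gt0.
have de2 : d <= e / 2 by rewrite ge_min lexx.
have de : d < e by lra.
have d1 : d <= 1 / 2 by rewrite ge_min lexx orbT.
have [xh|xh] := leP x (1/2).
- apply: (H (x + d)) => /=.
  + by rewrite opprD addNKr normrN gtr0_norm.
  + by rewrite -subr_eq0 addrAC subrr add0r gt_eqF.
  + by rewrite in_itv /=; apply/andP; split; lra.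
- apply: (H (x - d)) => /=.
  + by rewrite opprB addrC subrK gtr0_norm.
  + by rewrite -subr_eq0 addrAC subrr add0r oppr_eq0 gt_eqF.
  + by rewrite in_itv /=; apply/andP; split; lra.
Qed.

Definition pos : set R := [set x | 0 < x].

Lemma nbhs_pos x : 0 < x -> \forall y \near x, pos y.
Proof. move=> x0; exact: lt_nbhsr. Qed.

(** At interior points the restriction to the half-line is invisible, so
derivatives relative to it are ordinary derivatives. *)
Lemma dnbhs_pos x : 0 < x -> within pos x^' = x^'.
Proof.
move=> x0; rewrite /within; apply/seteqP; split => P /= H.
  have : \forall y \near x^', pos y by apply: nbhs_dnbhs; exact: nbhs_pos.
  move=> H'; near=> y; apply: (near H y) => //; near: y; exact: H'.
by near=> y => _; near: y.
Unshelve. all: by end_near. Qed.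

Lemma perfect_pos : perfect_set pos.
Proof. move=> x x0; rewrite dnbhs_pos//; exact: Proper_dnbhs_numFieldType. Qed.

Lemma diff_quotient_derive f x l :
  diff_quotient f x y @[y --> x^'] --> l <-> is_derive x 1 f l.
Proof.
have E : (diff_quotient f x y @[y --> x^'] --> l) <->
   (h^-1 *: (f (h *: 1 + x) - f x) @[h --> 0^'] --> l).
  split=> /cvgrPdist_le H; apply/cvgrPdist_le => e e0;
    have [d /= d0 Hd] := H e e0; exists d => // y /=; rewrite ?sub0r ?normrN => yd y0.
  - have := Hd (y + x); rewrite /= opprD addrC subrK normrN => /(_ yd).
    rewrite -subr_eq0 addrK => /(_ y0).
    by rewrite /diff_quotient addrK /GRing.scale /= mulr1.
  - have := Hd (y - x); rewrite /= sub0r normrN distrC => /(_ yd).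
    rewrite subr_eq0 => /(_ y0).
    by rewrite /diff_quotient /GRing.scale /= mulr1 subrK.
rewrite E; split=> [H|[H1 <-]]; last exact: H1.
by split; [apply/cvg_ex; exists l|apply/cvg_lim].
Qed.

Lemma deriv_on_pos f g : deriv_on pos f g <-> forall x, 0 < x -> is_derive x 1 f (g x).
Proof.
split=> H x x0.
  by apply/diff_quotient_derive; rewrite -dnbhs_pos//; exact: H.
by have /diff_quotient_derive := H x x0; rewrite dnbhs_pos.
Qed.

Section Mx.
Variables (p q : nat).
Implicit Type M : R -> 'M[R]_(p, q).

Lemma cvg_mxP (T : Type) (F : set_system T) (FF : Filter F)
   (M : T -> 'M[R]_(p, q)) (L : 'M[R]_(p, q)) :
  M y @[y --> F] --> L <-> forall i j, M y i j @[y --> F] --> L i j.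
Proof.
split=> [/cvgrPdist_le H i j|H].
  apply/cvgrPdist_le => e e0; near=> y.
  apply: le_trans (_ : `|L - M y| <= e); last by near: y; exact: H.
  rewrite [leRHS]/Num.Def.normr/= mx_normrE.
  by apply: le_trans; last exact: (le_bigmax _ _ (i, j)); rewrite !mxE.
apply/cvgrPdist_le => e e0; near=> y.
rewrite /Num.Def.normr/= mx_normrE (bigmax_le _ (ltW e0))//= => i _.
rewrite !mxE/=.
move: i; near: y; apply: filter_forall => /= i.
exact: ((cvgrPdist_le _ _).1 (H i.1 i.2)).
Unshelve. all: by end_near. Qed.

(** Iterated derivatives of a matrix-valued function are computed entrywise as
soon as the entries are smooth; this reduces all equations to scalar ones. *)
Lemma deriven_within_mx (D : set R) M : perfect_set D ->
  (forall i j, smooth_on D (fun x => M x i j)) ->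
  forall n x, D x -> forall i j,
    deriven_within D n M x i j = deriven_within D n (fun x => M x i j) x.
Proof.
move=> pD HM; elim=> [//|n IH] x Dx i j; rewrite /=.
have ? := pD _ Dx.
rewrite [in LHS]/derive_within.
suff -> : lim (diff_quotient (deriven_within D n M) x y @[y --> within D x^'])
   = \matrix_(i, j) (deriven_within D n.+1 (fun x => M x i j) x)
  by rewrite mxE.
apply: cvg_lim => //; apply/cvg_mxP => k l; rewrite mxE.
have := @smooth_on_deriv_on _ _ pD _ n (HM k l) x Dx.
apply: cvg_within_eq => y Dy _.
by rewrite /diff_quotient !mxE !IH.
Qed.

Lemma deriv_on_pos_mx M i j : (forall x, 0 < x -> derivable M x 1) ->
  deriv_on pos (fun x => M x i j) (fun x => derive1 M x i j).
Proof.
move=> HM; apply/deriv_on_pos => x x0.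
have Mx := HM _ x0.
rewrite derive1E derive_mx// mxE; apply: derivableP.
exact: (derivable_mxP _ _ _).1.
Qed.

(** The counterpart for ordinary derivatives on the half-line: it also yields
differentiability of every order of the matrix-valued function. *)
Lemma derive1n_mx M : (forall i j, smooth_on pos (fun x => M x i j)) ->
  forall n x, 0 < x -> derivable (derive1n n M) x 1 /\
  forall i j, derive1n n M x i j = deriven_within pos n (fun x => M x i j) x.
Proof.
move=> HM n.
suff H : forall x, 0 < x ->
  forall i j, derive1n n M x i j = deriven_within pos n (fun x => M x i j) x.
  move=> x x0; split; last exact: H.
  apply/derivable_mxP => i j.
  have [d _] := (deriv_on_pos _ _).1 (@smooth_on_deriv_on _ _ perfect_pos _ n (HM i j)) x x0.
  move: d; apply: near_eq_derivable.
  near=> y; rewrite H//; near: y; exact: nbhs_pos.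
elim: n => [//|n IH] x x0 i j.
have Hd k l : is_derive x 1 (fun x => derive1n n M x k l)
      (deriven_within pos n.+1 (fun x => M x k l) x).
  have := (deriv_on_pos _ _).1 (@smooth_on_deriv_on _ _ perfect_pos _ n (HM k l)) x x0.
  apply: near_eq_is_derive.
  near=> y; rewrite IH//; near: y; exact: nbhs_pos.
rewrite derive1nS derive1E derive_mx ?mxE.
  by have [_ ->] := Hd i j.
by apply/derivable_mxP => k l; case: (Hd k l).
Unshelve. all: by end_near. Qed.

End Mx.

Lemma smooth_on_sum (D : set R) (I : Type) (r : seq I) (P : pred I) (F : I -> R -> R) :
  (forall i, smooth_on D (F i)) ->
  smooth_on D (fun x => \sum_(i <- r | P i) F i x).
Proof.
move=> HF n; elim: r => [|i r IH].
  apply: diff_class_ext (@diff_class_cst _ D n 0) => x _.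
  by rewrite big_nil.
have := if P i as b return (diff_class D n (if b then F i \+ (fun x => \sum_(i <- r | P i) F i x)
   else (fun x => \sum_(i <- r | P i) F i x))) then diff_classD (HF i n) IH else IH.
apply: diff_class_ext => x _; rewrite big_cons; by case: (P i).
Qed.

End Concrete.

(** * Taylor coefficients at the left end point *)

Section Taylor.
Context {R : realType}.
Implicit Types (f g : R -> R) (x : R).

Lemma I01_0 : @I01 R 0. Proof. by rewrite /I01 /= in_itv /= lexx ler01. Qed.

Definition taylor_coef f n : R := deriven_within I01 n f 0 / n`!%:R.

Lemma taylor_coef0 f : taylor_coef f 0 = f 0.
Proof. by rewrite /taylor_coef /= fact0 divr1. Qed.

Lemma taylor_coefS f n :
  n.+1%:R * taylor_coef f n.+1 = taylor_coef (derive_within I01 f) n.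
Proof.
rewrite /taylor_coef /deriven_within iterSr factS natrM.
have ? : n`!%:R != 0 :> R by rewrite pnatr_eq0 -lt0n fact_gt0.
by have ? : n.+1%:R != 0 :> R; [rewrite pnatr_eq0|field; rewrite nat1r; apply/andP].
Qed.

Lemma taylor_coef_ext f g n : {in I01, f =1 g} -> taylor_coef f n = taylor_coef g n.
Proof.
move=> fg; rewrite /taylor_coef (deriven_within_ext _ fg)// inE; exact: I01_0.
Qed.

Lemma derive_within01 f g x : deriv_on I01 f g -> I01 x -> derive_within I01 f x = g x.
Proof. exact/deriv_on_derive/perfect_I01. Qed.

Lemma smooth_derive01 f : smooth_on I01 f -> deriv_on I01 f (derive_within I01 f) /\
  smooth_on I01 (derive_within I01 f).
Proof.
move=> sf; split; first by case: (diff_class_derive perfect_I01 (sf 1%N)).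
by move=> n; case: (diff_class_derive perfect_I01 (sf n.+1)).
Qed.

Lemma taylor_coefD f g n : smooth_on I01 f -> smooth_on I01 g ->
  taylor_coef (f \+ g) n = taylor_coef f n + taylor_coef g n.
Proof.
elim: n f g => [|n IH] f g sf sg; first by rewrite !taylor_coef0.
have [df sf'] := smooth_derive01 sf; have [dg sg'] := smooth_derive01 sg.
have n0 : n.+1%:R != 0 :> R by rewrite pnatr_eq0.
apply: (mulfI n0); rewrite [RHS]mulrDr 3!taylor_coefS -(IH _ _ sf' sg').
apply: taylor_coef_ext => x /set_mem Ix /=.
exact: (derive_within01 (deriv_onD df dg)).
Qed.

(** Cauchy product. By [taylor_coefS] the induction step reduces to splitting
[n + 1] as [k + (n + 1 - k)] in each term. *)
Lemma taylor_coefM f g n : smooth_on I01 f -> smooth_on I01 g ->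
  taylor_coef (f \* g) n = \sum_(k < n.+1) taylor_coef f k * taylor_coef g (n - k).
Proof.
elim: n f g => [|n IH] f g sf sg.
  by rewrite big_ord_recl big_ord0 !taylor_coef0 addr0.
have [df sf'] := smooth_derive01 sf; have [dg sg'] := smooth_derive01 sg.
have n0 : n.+1%:R != 0 :> R by rewrite pnatr_eq0.
apply: (mulfI n0); rewrite taylor_coefS.
rewrite (@taylor_coef_ext _ ((derive_within I01 f \* g) \+ (f \* derive_within I01 g))); last first.
  by move=> x /set_mem Ix /=; exact: (derive_within01 (deriv_onM df dg)).
rewrite taylor_coefD; [|by move=> k; exact: diff_classM|by move=> k; exact: diff_classM].
rewrite !IH// mulr_sumr.
transitivity (\sum_(k < n.+2) (k%:R * taylor_coef f k * taylor_coef g (n.+1 - k)) +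
  \sum_(k < n.+2) ((n.+1 - k)%:R * taylor_coef f k * taylor_coef g (n.+1 - k))).
  congr (_ + _).
    rewrite [RHS]big_ord_recl /= mulr0n !mul0r add0r; apply: eq_bigr => k _.
    by rewrite -taylor_coefS /bump leq0n add1n subSS.
  rewrite [RHS]big_ord_recr /= subnn mulr0n !mul0r addr0; apply: eq_bigr => k _.
  by rewrite -taylor_coefS subSn -1?ltnS//; ring.
rewrite -big_split /=; apply: eq_bigr => k _.
by rewrite -!mulrDl -natrD subnKC ?mulrA// -ltnS; exact: ltn_ord.
Qed.

Lemma taylor_coefZ (c : R) f n : smooth_on I01 f ->
  taylor_coef (fun x => c * f x) n = c * taylor_coef f n.
Proof.
elim: n f => [|n IH] f sf; first by rewrite !taylor_coef0.
have [df sf'] := smooth_derive01 sf.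
have n0 : n.+1%:R != 0 :> R by rewrite pnatr_eq0.
apply: (mulfI n0); rewrite [RHS]mulrCA !taylor_coefS -(IH _ sf').
apply: taylor_coef_ext => x /set_mem Ix /=.
by rewrite (derive_within01 (deriv_onM (@deriv_on_cst _ _ c) df))//= mul0r add0r.
Qed.

(** The essential supremum over the open interval bounds the value at the end
point: otherwise, by continuity, the bound would fail on an interval
[(0, d)], which has positive measure. *)
Lemma Linfty_norm01_bound f (M : R) :
  f y @[y --> within I01 (0 : R)^'] --> f 0 ->
  (Linfty_norm01 f <= M%:E)%E -> `|f 0| <= M.
Proof.
move=> cf; rewrite /Linfty_norm01 unlock.
have itvE (d : R) : 0 < d -> (lebesgue_measure (`]0%R, d[%classic : set R) = d%:E)%E.
  by move=> d0; rewrite lebesgue_measure_itv /= lte_fin d0 oppr0 adde0.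
have -> : (0 < lebesgue_measure [set: R])%E.
  apply: (@lt_le_trans _ _ (lebesgue_measure (`]0%R, 1%R[%classic : set R))).
    by rewrite itvE ?lte_fin.
  by apply: le_measure; rewrite ?inE.
move=> /ess_supP => -[N [mN N0 HN]].
rewrite leNgt; apply/negP => Mf.
have : \forall y \near within I01 (0 : R)^', M < `|f y|.
  have H : `|f y| @[y --> within I01 (0 : R)^'] --> `|f 0| by apply: cvg_norm.
  by apply: cvgr_gt; [exact: H|exact: Mf].
rewrite /within /= => -[e /= e0 He].
pose d : R := Num.min e 1.
have d0 : 0 < d by rewrite lt_min e0 ltr01.
have dN : `]0%R, d[%classic `<=` N.
  move=> y /=; rewrite in_itv /= => /andP[y0 yd].
  have ye : y < e by apply: lt_le_trans yd _; rewrite ge_min lexx.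
  have y1 : y < 1 by apply: lt_le_trans yd _; rewrite ge_min lexx orbT.
  apply: HN => /=; apply/negP; rewrite -ltNge lte_fin patchE mem_set; last first.
    by rewrite /= in_itv /= y0 y1.
  apply: He => /=; first by rewrite sub0r normrN gtr0_norm.
    by rewrite gt_eqF.
  by rewrite /I01 /= in_itv /= !ltW.
have : (lebesgue_measure (`]0%R, d[%classic : set R) <= lebesgue_measure N)%E.
  by apply: le_measure; rewrite ?inE.
by rewrite itvE// N0 lee_fin leNgt d0.
Qed.

Lemma analytic01_smooth C gam f : analytic01 C gam f -> smooth_on I01 f.
Proof.
move=> H; apply: derivable_smooth_on => n x Ix.
by have [+ _] := H n; apply; move: Ix; rewrite /I01 /= in_itv.
Qed.

Lemma analytic01_taylor C gam f n : analytic01 C gam f ->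
  `|taylor_coef f n| <= C * gam ^+ n.
Proof.
move=> H; have sf := analytic01_smooth H.
have [_ Hn] := H n.
rewrite /taylor_coef normrM normfV (@ger0_norm _ n`!%:R)//.
rewrite ler_pdivrMr ?ltr0n ?fact_gt0//.
apply: Linfty_norm01_bound Hn.
apply: deriv_on_cvg I01_0; exact: (@smooth_on_deriv_on _ _ perfect_I01 _ n sf).
Qed.

End Taylor.

(** * Two by two systems and a triangular recursion *)

Section TwoByTwo.
Context {R : realType}.

Lemma sum_ord2 (V : nmodType) (F : 'I_2 -> V) : \sum_(l < 2) F l = F 0 + F 1.
Proof.
rewrite big_ord_recl big_ord1; congr (_ + F _); exact: val_inj.
Qed.

Lemma ord2_ind (P : 'I_2 -> Prop) : P 0 -> P 1 -> forall j, P j.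
Proof.
move=> P0 P1 [[|[|//]] i].
  by rewrite (_ : Ordinal i = 0)//; apply: val_inj.
by rewrite (_ : Ordinal i = 1)//; apply: val_inj.
Qed.

Definition coercive2 (alpha : R) (a : 'I_2 -> 'I_2 -> R) :=
  forall xi : 'I_2 -> R,
    alpha ^+ 2 * \sum_j xi j ^+ 2 <= \sum_j xi j * \sum_l a j l * xi l.

Lemma coercive2_mx alpha (B : 'M[R]_2) :
  (forall xi : 'cV[R]_2,
    alpha ^+ 2 * (xi^T *m xi) 0 0 <= (xi^T *m B *m xi) 0 0) ->
  coercive2 alpha (fun j l => B j l).
Proof.
move=> H xi; have := H (\col_j xi j).
rewrite -mulmxA !mxE !sum_ord2 !mxE !sum_ord2 !mxE !expr2; exact.
Qed.

(** Test the system against its solution: [alpha^2 |xi|^2 <= xi . b]. The factor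
2 compares the Euclidean norm with the sum norm in dimension two. *)
Lemma coercive2_le alpha a (xi b : 'I_2 -> R) : 0 < alpha -> coercive2 alpha a ->
  (forall j, \sum_l a j l * xi l = b j) ->
  \sum_j `|xi j| <= 2 / alpha ^+ 2 * \sum_j `|b j|.
Proof.
move=> al0 /(_ xi) H E; move: H.
have {}E j : a j 0 * xi 0 + a j 1 * xi 1 = b j by rewrite -E sum_ord2.
rewrite !sum_ord2 !E.
move: (xi 0) (xi 1) (b 0) (b 1) => p q c d H.
have a2 : 0 < alpha ^+ 2 by rewrite exprn_gt0.
have h1 : p * c + q * d <= (`|p| + `|q|) * (`|c| + `|d|).
  have := ler_norm (p * c); have := ler_norm (q * d); rewrite !normrM.
  have := mulr_ge0 (normr_ge0 p) (normr_ge0 d).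
  have := mulr_ge0 (normr_ge0 q) (normr_ge0 c); lra.
have h2 : (`|p| + `|q|) ^+ 2 <= 2 * (p ^+ 2 + q ^+ 2).
  rewrite -(real_normK (num_real p)) -(real_normK (num_real q)).
  have := sqr_ge0 (`|p| - `|q|); nra.
rewrite mulrAC ler_pdivlMr//.
have := addr_ge0 (normr_ge0 p) (normr_ge0 q).
have := addr_ge0 (normr_ge0 c) (normr_ge0 d).
move: (`|p| + `|q|) (`|c| + `|d|) h1 h2 => s t h1 h2 t0 s0.
have h3 : alpha ^+ 2 * s ^+ 2 <= 2 * (s * t).
  apply: le_trans (_ : alpha ^+ 2 * (2 * (p ^+ 2 + q ^+ 2)) <= _).
    by rewrite ler_pM2l.
  by rewrite mulrCA ler_pM2l// (le_trans H).
have [->|sn0] := eqVneq s 0; first by rewrite mul0r mulr_ge0.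
have sp : 0 < s by rewrite lt_neqAle eq_sym sn0.
rewrite -(ler_pM2l sp); move: h3; rewrite expr2; lra.
Qed.

(** The kernel vector [(- a01, a00)] of a singular matrix would violate
coercivity, since [a00 > 0]. *)
Lemma coercive2_det alpha a : 0 < alpha -> coercive2 alpha a ->
  a 0 0 * a 1 1 - a 0 1 * a 1 0 != 0.
Proof.
move=> al0 H; apply/eqP => D.
have a2 : 0 < alpha ^+ 2 by rewrite exprn_gt0.
have a00 : 0 < a 0 0.
  have := H (fun j => if j == 0 then 1 else 0).
  rewrite !sum_ord2 /= !mulr0 !addr0 mul0r addr0 expr1n expr0n /= addr0 !mul1r !mulr1; exact: lt_le_trans.
have := H (fun j => if j == 0 then - a 0 1 else a 0 0).
rewrite !sum_ord2 /=.
suff -> : - a 0 1 * (a 0 0 * - a 0 1 + a 0 1 * a 0 0) + a 0 0 * (a 1 0 * - a 0 1 + a 1 1 * a 0 0) = 0.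
  apply/negP; rewrite -ltNge mulr_gt0// ltr_wpDl ?sqr_ge0// exprn_gt0//.
transitivity (a 0 0 * (a 0 0 * a 1 1 - a 0 1 * a 1 0)); first by ring.
by rewrite D mulr0.
Qed.

Lemma cramer2 (a : 'I_2 -> 'I_2 -> R) (u b : 'I_2 -> R) :
  a 0 0 * a 1 1 - a 0 1 * a 1 0 != 0 ->
  (forall j, \sum_l a j l * u l = b j) ->
  u 0 = (a 1 1 * b 0 - a 0 1 * b 1) * (a 0 0 * a 1 1 - a 0 1 * a 1 0)^-1 /\
  u 1 = (a 0 0 * b 1 - a 1 0 * b 0) * (a 0 0 * a 1 1 - a 0 1 * a 1 0)^-1.
Proof.
move=> D E; rewrite -!E !sum_ord2; split; field; exact: D.
Qed.

End TwoByTwo.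

Section OuterRecursion.
Context {R : realType}.

(** This is [(n + i)! / n!], the growth of the Taylor coefficients of the outer
functions. *)
Definition rising n i := ((n + i) ^_ i)%N.

Lemma risingS n i : rising n i.+1 = ((n + i).+1 * rising n i)%N.
Proof. by rewrite /rising addnS ffactSS. Qed.

(** Applied twice, this says that the factor [(n + 1)(n + 2)] produced by two
derivatives turns the growth for order [i - 2] at index [n + 2] into the
growth for order [i] at index [n]. *)
Lemma rising_shift n i : (n.+1 * rising n.+1 i)%N = rising n i.+1.
Proof.
elim: i => [|i IH]; first by rewrite risingS /rising !ffactn0 addn0.
by rewrite risingS mulnCA IH [in RHS]risingS addSnnS.
Qed.

Lemma rising_leS n i : (rising n i <= rising n.+1 i)%N.
Proof.
elim: i => [|i IH]; first by rewrite /rising !ffactn0.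
by rewrite !risingS leq_mul// ltnS leq_add2r.
Qed.

Lemma rising_le m n i : (m <= n)%N -> (rising m i <= rising n i)%N.
Proof.
move=> /subnK <-; elim: (n - m)%N => [//|k IH]; apply: leq_trans IH _.
by rewrite addSn rising_leS.
Qed.

Lemma rising0 i : rising 0 i = i`!. Proof. by rewrite /rising add0n ffactnn. Qed.

Lemma fact_le_exp n : (n`! <= n ^ n)%N.
Proof.
elim: n => [//|n IH]; rewrite factS expnS leq_mul//.
by apply: leq_trans IH _; case: n => // n; rewrite leq_exp2r.
Qed.

Lemma geometric_le (rho : R) n : 0 <= rho -> rho <= 2^-1 ->
  \sum_(k < n) rho ^+ k.+1 <= 2 * rho.
Proof.
move=> r0 r2.
suff : \sum_(k < n) rho ^+ k.+1 <= 2 * rho - 2 * rho ^+ n.+1.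
  have := exprn_ge0 n.+1 r0; lra.
elim: n => [|n IH]; first by rewrite big_ord0 expr1 subrr.
rewrite big_ord_recr /=; have : rho ^+ n.+2 <= 2^-1 * rho ^+ n.+1.
  by rewrite exprS ler_wpM2r// exprn_ge0.
lra.
Qed.

(** The majorant [K^i L^n (n+i)!/n!] is invariant under the recursion. The
convolution is geometric because the factorial quotient is monotone in [n], and
[L] large makes it at most half of the majorant. The term with two derivatives
reproduces the factorial quotient exactly by [rising_shift], and [K] large
compared with [L] makes it the other half. *)
Lemma outer_recursion (N G : nat -> nat -> R) (c Ca gam C0 L K : R) :
  0 < c -> 0 < Ca -> 0 < gam -> 0 < C0 -> 0 < K ->
  2 * gam <= L -> 8 * c * Ca * gam <= L -> 2 * c * L ^+ 2 <= K ^+ 2 ->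
  (forall i n, N i n <= c * (G i n
     + (if i is i'.+2 then (n.+1 * n.+2)%:R * N i' n.+2 else 0)
     + 2 * Ca * \sum_(k < n) gam ^+ k.+1 * N i (n - k.+1)%N)) ->
  (forall i n, (0 < i)%N -> G i n = 0) ->
  (forall n, G 0%N n <= C0 * L ^+ n) ->
  forall i n, N i n <= 2 * c * C0 * K ^+ i * L ^+ n * (rising n i)%:R.
Proof.
move=> c0 Ca0 g0 C00 K0 Lg Lc KL HN HG HG0.
have L0 : 0 < L by lra.
pose B i n : R := 2 * c * C0 * K ^+ i * L ^+ n * (rising n i)%:R.
have B0 i n : 0 <= B i n by rewrite /B !mulr_ge0 ?exprn_ge0 ?ler0n//; lra.
have Hmain i n : G i n + (if i is i'.+2 then (n.+1 * n.+2)%:R * B i' n.+2 else 0)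
   <= c^-1 * (B i n / 2).
  case: i => [|[|i]].
  - rewrite addr0 (le_trans (HG0 n))// /B expr0 mulr1 /rising ffactn0 mulr1 le_eqVlt; apply/orP; left; apply/eqP; field; lra.
  - by rewrite addr0 HG// mulr_ge0 ?invr_ge0 ?(ltW c0)// divr_ge0.
  - rewrite HG// add0r /B.
    have -> : (rising n i.+2)%:R = (n.+1 * n.+2)%:R * (rising n.+2 i)%:R :> R.
      by rewrite -natrM -mulnA rising_shift rising_shift.
    set r := (n.+1 * n.+2)%:R * (rising n.+2 i)%:R : R.
    have r0 : 0 <= r by rewrite mulr_ge0.
    have -> : (n.+1 * n.+2)%:R * (2 * c * C0 * K ^+ i * L ^+ n.+2 * (rising n.+2 i)%:R)
      = (2 * c * L ^+ 2) * (C0 * K ^+ i * L ^+ n * r) by rewrite /r -(addn2 n) exprD; ring.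
    have -> : c^-1 * (2 * c * C0 * K ^+ i.+2 * L ^+ n * r / 2) = K ^+ 2 * (C0 * K ^+ i * L ^+ n * r).
      by rewrite -(addn2 i) exprD; field; lra.
    rewrite ler_wpM2r// !mulr_ge0 ?exprn_ge0//; lra.
have Hconv i n : 2 * Ca * \sum_(k < n) gam ^+ k.+1 * B i (n - k.+1)%N <= c^-1 * (B i n / 2).
  pose rho := gam / L.
  have r0 : 0 <= rho by rewrite divr_ge0 ?ltW.
  have r1 : rho <= 2^-1 by rewrite ler_pdivrMr//; lra.
  have r2 : 4 * Ca * rho * c <= 2^-1.
    rewrite /rho !mulrA mulrAC ler_pdivrMr//; lra.
  have Ca2 : 0 <= 2 * Ca by lra.
  apply: le_trans (_ : 2 * Ca * ((\sum_(k < n) rho ^+ k.+1) * B i n) <= _).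
    rewrite mulr_suml ler_wpM2l//.
    apply: ler_sum => k _; rewrite /B.
    have kn : (k.+1 <= n)%N by [].
    have -> : L ^+ n = L ^+ (n - k.+1) * L ^+ k.+1 by rewrite -exprD subnK.
    have -> : rho ^+ k.+1 * (2 * c * C0 * K ^+ i * (L ^+ (n - k.+1) * L ^+ k.+1) * (rising n i)%:R)
      = gam ^+ k.+1 * (2 * c * C0 * K ^+ i * L ^+ (n - k.+1) * (rising n i)%:R).
      rewrite /rho expr_div_n; field; rewrite expf_neq0//; lra.
    rewrite ler_wpM2l ?exprn_ge0 ?(ltW g0)// ler_wpM2l//.
      by rewrite !mulr_ge0 ?exprn_ge0//; lra.
    by rewrite ler_nat rising_le// leq_subr.
  have := geometric_le n r0 r1; set s := \sum_(k < n) _ => Hs.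
  apply: le_trans (_ : 2 * Ca * (2 * rho * B i n) <= _).
    by rewrite ler_wpM2l// ler_wpM2r.
  rewrite ler_pdivlMl//.
  have -> : c * (2 * Ca * (2 * rho * B i n)) = (4 * Ca * rho * c) * B i n by ring.
  by rewrite mulrC ler_wpM2l.
move=> i n; rewrite -/(B i n); elim/ltn_ind: i n => i IHi n.
elim/ltn_ind: n => n IHn.
apply: le_trans (HN i n) _; rewrite -ler_pdivlMl//.
have -> : c^-1 * B i n = c^-1 * (B i n / 2) + c^-1 * (B i n / 2) by field; lra.
apply: lerD; last first.
  apply: le_trans (Hconv i n); rewrite ler_wpM2l//; first lra.
  apply: ler_sum => k _; rewrite ler_wpM2l ?exprn_ge0 ?(ltW g0)// IHn//.
  have := ltn_ord k; lia.
apply: le_trans (Hmain i n); rewrite lerD2l.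
case: i IHi {IHn} => [|[|i]] // IHi.
by rewrite ler_wpM2l// IHi.
Qed.

End OuterRecursion.

(** * Growth of the outer functions at the left end point *)

Section Outer.
Context {R : realType}.
Variables (f g : R -> R) (A : R -> 'M[R]_2)
    (Cf gammaf Cg gammag Ca gammaa alpha : R).
Hypotheses (hCf : 0 < Cf) (hgammaf : 0 < gammaf)
    (hCg : 0 < Cg) (hgammag : 0 < gammag)
    (hCa : 0 < Ca) (hgammaa : 0 < gammaa)
    (hf : analytic01 Cf gammaf f)
    (hg : analytic01 Cg gammag g)
    (hA : forall i j : 'I_2, analytic01 Ca gammaa (fun x => A x i j))
    (halpha : 0 < alpha)
    (hcoer : forall (xi : 'cV[R]_2) (x : R), 0 <= x <= 1 ->
       alpha ^+ 2 * (xi^T *m xi) 0 0 <= (xi^T *m A x *m xi) 0 0).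

Lemma smooth_A j l : smooth_on I01 (fun x => A x j l).
Proof. exact: analytic01_smooth (hA j l). Qed.

Lemma Acoef_taylor k j l : Acoef A k j l = taylor_coef (fun x => A x j l) k.
Proof.
rewrite /Acoef mxE (deriven_within_mx perfect_I01); last exact: I01_0.
  by rewrite mulrC.
exact: smooth_A.
Qed.

Lemma Acoef_le k j l : `|Acoef A k j l| <= Ca * gammaa ^+ k.
Proof. by rewrite Acoef_taylor; exact: analytic01_taylor. Qed.

Lemma I01P (x : R) : I01 x -> 0 <= x <= 1.
Proof. by rewrite /I01 /= in_itv. Qed.

Lemma coercive_A x : I01 x -> coercive2 alpha (fun j l => A x j l).
Proof. by move=> /I01P Ix; apply: coercive2_mx => xi; exact: hcoer. Qed.

Definition rhs_entry i (j : 'I_2) : R -> R := fun x => Frhs f g i x j 0.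

Lemma smooth_rhs i j : smooth_on I01 (rhs_entry i j).
Proof.
have sf := analytic01_smooth hf; have sg := analytic01_smooth hg.
move=> n; case: i => [|i].
  elim/ord2_ind: j.
    by apply: diff_class_ext (sf n) => x _; rewrite /rhs_entry /= mxE.
  by apply: diff_class_ext (sg n) => x _; rewrite /rhs_entry /= mxE.
by apply: diff_class_ext (@diff_class_cst _ I01 n 0) => x _; rewrite /rhs_entry /= mxE.
Qed.

Lemma taylor_rhs n :
  \sum_j `|taylor_coef (rhs_entry 0 j) n| <= Cf * gammaf ^+ n + Cg * gammag ^+ n.
Proof.
rewrite sum_ord2; apply: lerD.
  rewrite (@taylor_coef_ext _ _ f); first exact: analytic01_taylor.
  by move=> x _; rewrite /rhs_entry /= mxE.
rewrite (@taylor_coef_ext _ _ g); first exact: analytic01_taylor.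
by move=> x _; rewrite /rhs_entry /= mxE.
Qed.

Variables (nu : R) (U : nat -> R -> 'cV[R]_2).
Hypotheses (nu_ge0 : 0 <= nu) (nu_le1 : nu <= 1) (HU : is_outer nu f g A U).

Definition Emx_entry (j : 'I_2) : R := if j == 0 then nu ^+ 2 else 1.

Lemma Emx_mul (v : 'cV[R]_2) j : (Emx nu *m v) j 0 = Emx_entry j * v j 0.
Proof. by rewrite /Emx mul_diag_mx !mxE. Qed.

Lemma Emx_entry_ge0 j : 0 <= Emx_entry j.
Proof. by rewrite /Emx_entry; case: ifP; rewrite ?sqr_ge0. Qed.

Lemma Emx_entry_le1 j : Emx_entry j <= 1.
Proof. by rewrite /Emx_entry; case: ifP => // _; rewrite exprn_ile1. Qed.

Lemma smooth_lag2 i :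
  (forall i', (i' < i)%N -> forall j, smooth_on I01 (fun x => U i' x j 0)) ->
  forall j k, smooth_on I01 (fun x => lag2 U i x j k).
Proof.
move=> IH j k n; rewrite (ord1 k).
case: i IH => [|[|i]] IH /=; try by
  apply: diff_class_ext (@diff_class_cst _ I01 n 0) => x _; rewrite mxE.
by apply: IH.
Qed.

Definition outer_rhs i j : R -> R := rhs_entry i j \+
  (cst (Emx_entry j) \* deriven_within I01 2 (fun x => lag2 U i x j 0)).

Lemma outer_entry i : (forall j k, smooth_on I01 (fun x => lag2 U i x j k)) ->
  forall x, I01 x -> forall j,
  \sum_l A x j l * U i x l 0 = outer_rhs i j x.
Proof.
move=> sl x Ix j.
have [_ _ /(congr1 (fun M : 'cV[R]_2 => M j 0))] := HU i (I01P Ix).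
rewrite [LHS]mxE [RHS]mxE Emx_mul => ->.
by rewrite (deriven_within_mx perfect_I01 sl).
Qed.

(** Cramer's rule expresses [U_i] through [A], the data and two derivatives of
[U_{i-2}], all smooth. *)
Lemma smooth_outer i j : smooth_on I01 (fun x => U i x j 0).
Proof.
elim/ltn_ind: i j => i IH.
have sl := smooth_lag2 IH.
have E := outer_entry sl.
have sG j : smooth_on I01 (outer_rhs i j).
  move=> n; apply: diff_classD; first exact: smooth_rhs.
  apply: diff_classM; first exact: diff_class_cst.
  exact: (@smooth_on_deriven _ _ perfect_I01 _ 2 (sl j 0) n).
pose det x := A x 0 0 * A x 1 1 - A x 0 1 * A x 1 0.
have det0 x : I01 x -> det x != 0.
  by move=> Ix; exact: coercive2_det halpha (coercive_A Ix).
have sAN : smooth_on I01 (fun x => - A x 0 1).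
  move=> n; apply: diff_class_ext (diff_classM (@diff_class_cst _ I01 n (-1)) (smooth_A 0 1 n)).
  by move=> x _ /=; rewrite mulN1r.
have sAN' : smooth_on I01 (fun x => - A x 1 0).
  move=> n; apply: diff_class_ext (diff_classM (@diff_class_cst _ I01 n (-1)) (smooth_A 1 0 n)).
  by move=> x _ /=; rewrite mulN1r.
have sdet : smooth_on I01 (fun x => (det x)^-1).
  move=> n; apply: diff_classV => //.
  apply: diff_class_ext (diff_classD (diff_classM (smooth_A 0 0 n) (smooth_A 1 1 n))
    (diff_classM (sAN n) (smooth_A 1 0 n))).
  by move=> x _ /=; rewrite mulNr.
elim/ord2_ind => n.
  apply: diff_class_ext (diff_classM (diff_classD (diff_classM (smooth_A 1 1 n) (sG 0 n))
    (diff_classM (sAN n) (sG 1 n))) (sdet n)) => x /set_mem Ix /=.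
  by rewrite (cramer2 (det0 x Ix) (E x Ix)).1 mulNr.
apply: diff_class_ext (diff_classM (diff_classD (diff_classM (smooth_A 0 0 n) (sG 1 n))
    (diff_classM (sAN' n) (sG 0 n))) (sdet n)) => x /set_mem Ix /=.
by rewrite (cramer2 (det0 x Ix) (E x Ix)).2 mulNr.
Qed.

Let N i n : R := \sum_l `|taylor_coef (fun x => U i x l 0) n|.

Lemma taylor_deriven2 (h : R -> R) n :
  taylor_coef (deriven_within I01 2 h) n = (n.+1 * n.+2)%:R * taylor_coef h n.+2.
Proof.
by rewrite /= -taylor_coefS -taylor_coefS mulrA natrM.
Qed.

(** Compare Taylor coefficients at 0 on both sides of the outer equation. *)
Lemma outer_taylor i n j :
  \sum_l \sum_(k < n.+1) Acoef A k j l * taylor_coef (fun x => U i x l 0) (n - k) =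
  taylor_coef (rhs_entry i j) n +
  Emx_entry j * ((n.+1 * n.+2)%:R * taylor_coef (fun x => lag2 U i x j 0) n.+2).
Proof.
have sl : forall j k, smooth_on I01 (fun x => lag2 U i x j k).
  by apply: smooth_lag2 => *; exact: smooth_outer.
have s2 := @smooth_on_deriven _ _ perfect_I01 _ 2 (sl j 0).
rewrite -taylor_deriven2 -taylor_coefZ// -taylor_coefD; last 2 first.
- exact: smooth_rhs.
- by move=> k; apply: (diff_classM (@diff_class_cst _ I01 k (Emx_entry j))); exact: s2.
rewrite -(@taylor_coef_ext _ (fun x => \sum_l A x j l * U i x l 0)); last first.
  by move=> x /set_mem Ix; rewrite outer_entry.
under eq_bigr => l _.
  under eq_bigr do rewrite Acoef_taylor.
  rewrite -(taylor_coefM _ (smooth_A j l) (smooth_outer i l)).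
  over.
rewrite sum_ord2 -taylor_coefD.
- by apply: taylor_coef_ext => x _; rewrite sum_ord2.
- by move=> k; exact: diff_classM (smooth_A _ _ k) (smooth_outer _ _ k).
- by move=> k; exact: diff_classM (smooth_A _ _ k) (smooth_outer _ _ k).
Qed.

(** Solve for the leading coefficient: the term with the undifferentiated
matrix [A_0] is inverted by coercivity, the others are estimated. *)
Lemma outer_taylor_le i n : N i n <= 2 / alpha ^+ 2 *
  (\sum_j `|taylor_coef (rhs_entry i j) n|
   + (if i is i'.+2 then (n.+1 * n.+2)%:R * N i' n.+2 else 0)
   + 2 * Ca * \sum_(k < n) gammaa ^+ k.+1 * N i (n - k.+1)%N).
Proof.
pose b j := taylor_coef (rhs_entry i j) n +
  Emx_entry j * ((n.+1 * n.+2)%:R * taylor_coef (fun x => lag2 U i x j 0) n.+2) -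
  \sum_(k < n) \sum_l Acoef A k.+1 j l * taylor_coef (fun x => U i x l 0) (n - k.+1).
have E j : \sum_l Acoef A 0 j l * taylor_coef (fun x => U i x l 0) n = b j.
  rewrite /b -outer_taylor [X in _ = X - _]exchange_big /=.
  rewrite [X in _ = X - _]big_ord_recl /= subn0.
  by rewrite addrK.
have HC : coercive2 alpha (fun j l => Acoef A 0 j l).
  move=> xi; have := coercive_A I01_0 xi.
  rewrite !sum_ord2 !Acoef_taylor !taylor_coef0; exact.
apply: le_trans (coercive2_le halpha HC E) _.
rewrite ler_wpM2l ?divr_ge0 ?exprn_ge0 ?(ltW halpha)//.
have lagE j : `|Emx_entry j * ((n.+1 * n.+2)%:R * taylor_coef (fun x => lag2 U i x j 0) n.+2)|
   <= (n.+1 * n.+2)%:R * `|taylor_coef (fun x => lag2 U i x j 0) n.+2|.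
  by rewrite normrM (ger0_norm (Emx_entry_ge0 j)) normrM normr_nat ler_piMl ?mulr_ge0 ?Emx_entry_le1.
have lagN : \sum_j (n.+1 * n.+2)%:R * `|taylor_coef (fun x => lag2 U i x j 0) n.+2|
   = (if i is i'.+2 then (n.+1 * n.+2)%:R * N i' n.+2 else 0).
  rewrite -mulr_sumr; case: i {b E lagE} => [|[|i]] //=; rewrite ?[LHS]mulr_sumr.
    apply: big1 => j _.
    rewrite (@taylor_coef_ext _ _ (fun x => 0 * 0)); last by move=> x _; rewrite mxE mul0r.
    by rewrite (@taylor_coefZ _ 0 (cst 0)) ?mul0r ?normr0 ?mulr0// => k; exact: diff_class_cst.
  apply: big1 => j _.
  rewrite (@taylor_coef_ext _ _ (fun x => 0 * 0)); last by move=> x _; rewrite mxE mul0r.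
  by rewrite (@taylor_coefZ _ 0 (cst 0)) ?mul0r ?normr0 ?mulr0// => k; exact: diff_class_cst.
have conv j : `|\sum_(k < n) \sum_l Acoef A k.+1 j l * taylor_coef (fun x => U i x l 0) (n - k.+1)|
   <= Ca * \sum_(k < n) gammaa ^+ k.+1 * N i (n - k.+1)%N.
  rewrite mulr_sumr; apply: le_trans (ler_norm_sum _ _ _) _; apply: ler_sum => k _.
  apply: le_trans (ler_norm_sum _ _ _) _; rewrite mulrA mulr_sumr; apply: ler_sum => l _.
  by rewrite normrM ler_wpM2r// Acoef_le.
apply: le_trans (_ : \sum_j (`|taylor_coef (rhs_entry i j) n| +
   (n.+1 * n.+2)%:R * `|taylor_coef (fun x => lag2 U i x j 0) n.+2| +
   Ca * \sum_(k < n) gammaa ^+ k.+1 * N i (n - k.+1)%N) <= _).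
  apply: ler_sum => j _; rewrite /b.
  apply: le_trans (ler_normB _ _) _; apply: lerD => //.
  by apply: le_trans (ler_normD _ _) _; apply: lerD.
rewrite !big_split /= lagN lerD2l [X in X <= _]sum_ord2; lra.
Qed.

End Outer.

(** The constants depend on the data only, uniformly in [nu], because
[E] multiplies known terms only and its entries are at most 1. *)
Lemma outer_at0_bound (R : realType) (f g : R -> R) (A : R -> 'M[R]_2)
    (Cf gammaf Cg gammag Ca gammaa alpha : R) :
  0 < Cf -> 0 < gammaf -> 0 < Cg -> 0 < gammag -> 0 < Ca -> 0 < gammaa ->
  analytic01 Cf gammaf f -> analytic01 Cg gammag g ->
  (forall i j : 'I_2, analytic01 Ca gammaa (fun x => A x i j)) ->
  0 < alpha ->
  (forall (xi : 'cV[R]_2) (x : R), 0 <= x <= 1 ->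
     alpha ^+ 2 * (xi^T *m xi) 0 0 <= (xi^T *m A x *m xi) 0 0) ->
  exists C K : R, [/\ 0 < C, 0 < K & forall nu U, 0 <= nu -> nu <= 1 ->
    is_outer nu f g A U ->
    forall i j, `|U i 0 j 0| <= C * K ^+ i * (i ^ i)%:R].
Proof.
move=> Cf0 gf0 Cg0 gg0 Ca0 ga0 hf hg hA al0 hco.
pose c := 2 / alpha ^+ 2.
have c0 : 0 < c by rewrite divr_gt0// exprn_gt0.
pose L := gammaf + gammag + 2 * gammaa + 8 * c * Ca * gammaa.
have cg0 : 0 < 8 * c * Ca * gammaa by have := mulr_gt0 (mulr_gt0 c0 Ca0) ga0; lra.
have L0 : 0 < L by rewrite /L; lra.
(* [K^2 >= K >= 2 c L^2], as [K >= 1]. *)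
pose K := 2 * c * L ^+ 2 + 1.
have cL0 : 0 < 2 * c * L ^+ 2 by have := mulr_gt0 c0 (exprn_gt0 2 L0); lra.
have K0 : 0 < K by rewrite /K; lra.
exists (2 * c * (Cf + Cg)), K; split => //; first by have := mulr_gt0 c0 (addr_gt0 Cf0 Cg0); lra.
move=> nu U nu0 nu1 HU i j.
pose N i n := \sum_l `|taylor_coef (fun x => U i x l 0) n|.
pose G i n := \sum_j `|taylor_coef (rhs_entry f g i j) n|.
have := @outer_recursion R N G c Ca gammaa (Cf + Cg) L K c0 Ca0 ga0 _ K0 _ _ _ _ _ _ i 0.
rewrite rising0 expr0 mulr1 => H.
apply: (@le_trans _ _ (N i 0%N)).
  rewrite /N (bigD1 j)//= taylor_coef0 lerDl sumr_ge0//.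
apply: le_trans (H _ _ _ _ _ _ _) _ => {H}.
- exact: addr_gt0.
- by rewrite /L; lra.
- by rewrite /L; lra.
- rewrite /K; nra.
- move=> i' n; exact: (outer_taylor_le hf hg hA al0 hco nu0 nu1 HU).
- move=> [//|i'] n _; apply: big1 => l _.
  rewrite (@taylor_coef_ext _ _ (fun x => 0 * 0)); last by move=> x _; rewrite /rhs_entry /= mxE mul0r.
  by rewrite (@taylor_coefZ _ 0 (cst 0)) ?mul0r ?normr0 ?mulr0// => k; exact: diff_class_cst.
- move=> n; apply: le_trans (taylor_rhs hf hg n) _; rewrite mulrDl.
  have fL : gammaf <= L by rewrite /L; lra.
  have gL : gammag <= L by rewrite /L; lra.
  by apply: lerD; apply: ler_wpM2l; rewrite ?(ltW Cf0) ?(ltW Cg0)//;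
    apply: lerXn2r; rewrite ?nnegrE ?(ltW L0) ?(ltW gf0) ?(ltW gg0).
- rewrite ler_wpM2l ?ler_nat ?fact_le_exp//.
  rewrite mulr_ge0 ?exprn_ge0 ?(ltW K0)//.
  by have := mulr_gt0 c0 (addr_gt0 Cf0 Cg0); lra.
Qed.

(** * Integrals over the half-line *)

Section Integral.
Context {R : realType}.
Implicit Types (h k u v G : R -> R) (x y : R).

Local Notation mu := (@lebesgue_measure R).
Local Notation P := (`]0%R, +oo[%classic : set R).

Definition cont_pos h := forall x, 0 < x -> {for x, continuous h}.

Definition int_pos h : \bar R := (\int[mu]_(x in P) (h x)%:E)%E.

Lemma mem_halfline x : P x = (0 < x) :> Prop.
Proof. by rewrite /= in_itv /= andbT. Qed.

Lemma measurable_pos h : cont_pos h -> measurable_fun P (EFin \o h).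
Proof.
move=> ch; apply/measurable_EFinP; apply: open_continuous_measurable_fun.
  exact: interval_open.
by move=> x /set_mem; rewrite mem_halfline => x0; exact: ch.
Qed.

Lemma within_pos h a b : cont_pos h -> 0 < a -> {within `[a, b], continuous h}.
Proof.
move=> ch a0; apply: continuous_in_subspaceT => x /set_mem /=.
by rewrite in_itv /= => /andP[ax _]; apply: ch; exact: lt_le_trans ax.
Qed.

Lemma int_pos_le h k : cont_pos h -> cont_pos k ->
  (forall x, 0 < x -> 0 <= h x) ->
  (forall x, 0 < x -> h x <= k x) -> (int_pos h <= int_pos k)%E.
Proof.
move=> ch ck h0 hk; apply: ge0_le_integral => //=.
- by move=> x; rewrite in_itv /= andbT lee_fin; exact: h0.
- exact: measurable_pos.
- exact: measurable_pos.
- by move=> x; rewrite in_itv /= andbT lee_fin; exact: hk.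
Qed.

Lemma int_posZ h (c : R) : cont_pos h -> (forall x, 0 < x -> 0 <= h x) -> 0 <= c ->
  int_pos (fun x => c * h x) = (c%:E * int_pos h)%E.
Proof.
move=> ch h0 c0; rewrite /int_pos.
under eq_integral do rewrite EFinM.
rewrite ge0_integralZl_EFin//.
- by move=> x; rewrite mem_halfline lee_fin; exact: h0.
- exact: measurable_pos.
Qed.

Lemma int_posD h k : cont_pos h -> cont_pos k ->
  (forall x, 0 < x -> 0 <= h x) -> (forall x, 0 < x -> 0 <= k x) ->
  int_pos (fun x => h x + k x) = (int_pos h + int_pos k)%E.
Proof.
move=> ch ck h0 k0; rewrite /int_pos.
under eq_integral do rewrite EFinD.
rewrite ge0_integralD//.
- by move=> x; rewrite mem_halfline lee_fin; exact: h0.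
- exact: measurable_pos.
- by move=> x; rewrite mem_halfline lee_fin; exact: k0.
- exact: measurable_pos.
Qed.

Lemma bigcup_pos : \bigcup_n `[n.+1%:R^-1, n.+1%:R]%classic = P.
Proof.
apply/seteqP; split=> x.
  move=> [n _] /=; rewrite !in_itv /= andbT => /andP[+ _].
  by apply: lt_le_trans; rewrite invr_gt0.
rewrite mem_halfline => x0.
pose n := (Num.truncn x + Num.truncn x^-1)%N.
have h y : y < (Num.truncn y).+1%:R :> R by exact: truncnS_gt.
exists n => //=; rewrite in_itv /=; apply/andP; split.
  rewrite invf_ple ?posrE//; apply: le_trans (ltW (h _)) _.
  by rewrite ler_nat /n ltnS leq_addl.
by apply: le_trans (ltW (h _)) _; rewrite ler_nat /n ltnS leq_addr.
Qed.

(** On a compact interval, integrate [h <= G' + k] by the fundamental theorem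
of calculus. *)
Lemma int_itv_le h k G g (a b : R) : cont_pos h -> cont_pos k -> cont_pos g ->
  deriv_on pos G g -> 0 < a -> a < b ->
  (forall x, 0 < x -> 0 <= k x) ->
  (forall x, 0 < x -> h x <= g x + k x) ->
  (\int[mu]_(x in `[a, b]) (h x)%:E <= (G b - G a)%:E + int_pos k)%E.
Proof.
move=> ch ck cg dG a0 ab k0 hgk.
have ii u : cont_pos u -> mu.-integrable `[a, b] (EFin \o u).
  move=> cu; apply: continuous_compact_integrable; first exact: segment_compact.
  exact: within_pos.
have dG' x : 0 < x -> is_derive x 1 G (g x) by apply: (deriv_on_pos _ _).1.
have cG : cont_pos G.
  by move=> x x0; apply/differentiable_continuous/derivable1_diffP; case: (dG' x x0).
have cgk : cont_pos (fun x => g x + k x).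
  by move=> x x0; apply: continuousD; [exact: cg|exact: ck].
apply: (@le_trans _ _ (\int[mu]_(x in `[a, b]) (g x + k x)%:E)%E).
  apply: le_integral => //; [exact: ii|exact: (ii _ cgk)|].
  move=> x /set_mem /=; rewrite in_itv /= => /andP[ax _].
  by rewrite lee_fin hgk// (lt_le_trans a0).
under eq_integral do rewrite EFinD.
rewrite integralD//; [|exact: ii|exact: ii].
apply: leeD.
  rewrite (@continuous_FTC2 _ g G a b ab) ?EFinB//.
  - exact: within_pos.
  - split.
    + by move=> x; rewrite in_itv /= => /andP[ax _]; case: (dG' x (lt_trans a0 ax)).
    + by apply: cvg_at_right_filter; exact: cG.
    + by apply: cvg_at_left_filter; apply: cG; exact: lt_trans ab.
  - move=> x; rewrite in_itv /= => /andP[ax _].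
    by rewrite derive1E; case: (dG' x (lt_trans a0 ax)).
apply: ge0_subset_integral => //.
- exact: measurable_pos.
- by move=> x; rewrite mem_halfline lee_fin; exact: k0.
- move=> x /=; rewrite !in_itv /= andbT => /andP[ax _]; exact: lt_le_trans ax.
Qed.

(** The passage from a differential inequality to a bound for an integral over
the half-line. The primitive is controlled only on some intervals exhausting
the half-line, which is enough because [h] is nonnegative. *)
Lemma int_pos_le_primitive h k G g (c d : R) : cont_pos h -> cont_pos k -> cont_pos g ->
  deriv_on pos G g ->
  (forall x, 0 < x -> 0 <= h x) ->
  (forall x, 0 < x -> 0 <= k x) ->
  (forall x, 0 < x -> h x <= g x + k x) ->
  (forall a0 b0 : R, 0 < a0 -> exists a b : R, [/\ 0 < a, a < a0, b0 < b & G b - G a <= c]) ->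
  (int_pos k <= d%:E)%E ->
  (int_pos h <= (c + d)%:E)%E.
Proof.
move=> ch ck cg dG h0 k0 hgk Hab kd.
rewrite /int_pos -bigcup_pos.
have nd : nondecreasing_seq (fun n => (`[n.+1%:R^-1, n.+1%:R]%classic : set R)).
  move=> m n mn; rewrite subsetEset; apply: subset_itv; rewrite bnd_simp.
    by rewrite lef_pV2 ?posrE// ler_nat.
  by rewrite ler_nat.
have mh n : measurable_fun (`[n.+1%:R^-1, n.+1%:R]%classic : set R) (EFin \o h).
  apply: measurable_funS (measurable_pos ch) => //.
  move=> x /=; rewrite !in_itv /= andbT => /andP[nx _].
  by apply: lt_le_trans nx; rewrite invr_gt0.
have F0 n x : `[n.+1%:R^-1, n.+1%:R]%classic x -> (0 <= (h x)%:E)%E.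
  rewrite /= in_itv /= => /andP[nx _]; rewrite lee_fin h0//.
  by apply: lt_le_trans nx; rewrite invr_gt0.
pose F n : set R := `[n.+1%:R^-1, n.+1%:R]%classic.
have CV : (\int[mu]_(x in F n) (h x)%:E @[n --> \oo] -->
   \int[mu]_(x in \bigcup_n F n) (h x)%:E)%E.
  apply: ge0_nondecreasing_set_cvg_integral; [exact: nd| |exact: mh|exact: F0].
  by move=> i; exact: measurable_itv.
rewrite -(cvg_lim _ CV)//.
apply: lime_le.
  apply: ereal_nondecreasing_is_cvgn.
  apply: ge0_nondecreasing_set_nondecreasing_integral;
    [exact: nd| |exact: mh|exact: F0].
  by move=> i; exact: measurable_itv.
apply: nearW => n.
have [|a [b [a0 an nb Gc]]] := Hab n.+1%:R^-1 n.+1%:R; first by rewrite invr_gt0.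
have n1 : n.+1%:R^-1 <= n.+1%:R :> R.
  by rewrite (@le_trans _ _ 1)// ?invf_le1 ?ltr0n// ler1n.
have ab : a < b by apply: lt_trans an _; exact: le_lt_trans nb.
apply: (@le_trans _ _ (\int[mu]_(x in `[a, b]) (h x)%:E)%E).
  apply: ge0_subset_integral => //.
  - exact: measurable_itv.
  - apply: measurable_funS (measurable_pos ch) => //.
    by move=> x /=; rewrite !in_itv /= andbT => /andP[ax _]; exact: lt_le_trans ax.
  - move=> x /=; rewrite in_itv /= => /andP[ax _]; rewrite lee_fin h0//.
    exact: lt_le_trans ax.
  - by apply: subset_itv; rewrite bnd_simp ltW.
apply: le_trans (int_itv_le ch ck cg dG a0 ab k0 hgk) _.
by rewrite (EFinD c d) leeD// lee_fin.
Qed.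

End Integral.

(** * Exponentially weighted square norms *)

Section Weighted.
Context {R : realType}.
Implicit Types (u v : R -> R) (x y a b c d beta : R).

(** The weighted [L^2] norm of [u] is at most [c]; squared, so that no root has
to be taken until the end. *)
Definition wnorm_le (beta : R) u (c : R) : Prop :=
  (int_pos (fun x => expR (2 * beta * x) * u x ^+ 2)%R <= (c ^+ 2)%:E)%E.

Lemma deriv_on_cont_pos (f g : R -> R) : deriv_on pos f g -> cont_pos f.
Proof.
move=> /deriv_on_pos H x x0; have [df _] := H x x0.
exact/differentiable_continuous/derivable1_diffP.
Qed.

Lemma smooth_cont_pos (f : R -> R) : smooth_on pos f -> cont_pos f.
Proof. by move=> sf; have [g Hg _] := sf 1%N; exact: deriv_on_cont_pos Hg. Qed.

Lemma deriv_on_expR (c : R) : deriv_on pos (fun x => expR (c * x)) (fun x => c * expR (c * x)).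
Proof.
apply/deriv_on_pos => x x0; apply: trigger_derive.
by rewrite /GRing.scale /= mulr1 mulrC.
Qed.

Lemma smooth_expR (c : R) : smooth_on pos (fun x => expR (c * x)).
Proof.
elim=> [//|n IH]; exists (fun x => c * expR (c * x)); first exact: deriv_on_expR.
exact: (diff_classM (@diff_class_cst _ _ n c) IH).
Qed.

Lemma cont_posM (f g : R -> R) : cont_pos f -> cont_pos g ->
  cont_pos (fun x => f x * g x).
Proof. by move=> cf cg x x0; apply: continuousM; [exact: cf|exact: cg]. Qed.

Lemma cont_posD (f g : R -> R) : cont_pos f -> cont_pos g ->
  cont_pos (fun x => f x + g x).
Proof. by move=> cf cg x x0; apply: continuousD; [exact: cf|exact: cg]. Qed.

Lemma cont_pos_cst (c : R) : cont_pos (fun=> c).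
Proof. by move=> x x0; exact: cst_continuous. Qed.

Lemma cont_pos_expR (c : R) : cont_pos (fun x => expR (c * x)).
Proof. exact: smooth_cont_pos (smooth_expR c). Qed.

Lemma cont_pos_weight beta u : cont_pos u ->
  cont_pos (fun x => expR (2 * beta * x) * u x ^+ 2).
Proof.
move=> cu; apply: cont_posM; first exact: cont_pos_expR.
exact: cont_posM.
Qed.

Lemma weight_ge0 beta u x : 0 <= expR (2 * beta * x) * u x ^+ 2.
Proof. by rewrite mulr_ge0 ?expR_ge0 ?sqr_ge0. Qed.

Lemma weight_sqr beta u x :
  expR (2 * beta * x) * u x ^+ 2 = (expR (beta * x) * `|u x|) ^+ 2.
Proof.
rewrite exprMn real_normK ?num_real// -expRM_natl; congr (expR _ * _); ring.
Qed.

Lemma wnorm_weaken beta u a b : 0 <= a -> a <= b -> wnorm_le beta u a -> wnorm_le beta u b.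
Proof.
move=> a0 ab; rewrite /wnorm_le => H; apply: le_trans H _.
by rewrite lee_fin ler_pXn2r ?nnegrE// (le_trans a0).
Qed.

Lemma wnorm_dom beta beta' u v a c : cont_pos u -> cont_pos v -> 0 <= c ->
  (forall x, 0 < x -> expR (beta * x) * `|v x| <= c * (expR (beta' * x) * `|u x|)) ->
  wnorm_le beta' u a -> wnorm_le beta v (c * a).
Proof.
move=> cu cv c0 H; rewrite /wnorm_le => Hu.
apply: (@le_trans _ _ (int_pos (fun x => c ^+ 2 * (expR (2 * beta' * x) * u x ^+ 2)))).
  apply: int_pos_le.
  - exact: cont_pos_weight.
  - apply: cont_posM; [exact: cont_pos_cst|exact: cont_pos_weight].
  - by move=> x _; exact: weight_ge0.
  - move=> x x0; rewrite (weight_sqr beta v) (weight_sqr beta' u) -(exprMn 2 c).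
    by apply: lerXn2r; rewrite ?nnegrE ?H// !mulr_ge0 ?expR_ge0.
rewrite int_posZ ?sqr_ge0//; last 2 first.
- exact: cont_pos_weight.
- by move=> x _; exact: weight_ge0.
by rewrite exprMn (EFinM _ (a ^+ 2)); apply: lee_wpmul2l; rewrite // lee_fin sqr_ge0.
Qed.

Lemma wnormZ beta u a c : cont_pos u -> wnorm_le beta u a ->
  wnorm_le beta (fun x => c * u x) (`|c| * a).
Proof.
move=> cu; apply: wnorm_dom => //.
  by apply: cont_posM => //; exact: cont_pos_cst.
by move=> x _; rewrite normrM mulrCA.
Qed.

(** Minkowski's inequality, from the pointwise bound
[(u + v)^2 <= (a + b) (u^2 / a + v^2 / b)] with the weights given by the norms
themselves. *)
Lemma wnormD beta u v a b : cont_pos u -> cont_pos v -> 0 < a -> 0 < b ->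
  wnorm_le beta u a -> wnorm_le beta v b -> wnorm_le beta (fun x => u x + v x) (a + b).
Proof.
move=> cu cv a0 b0; rewrite /wnorm_le => Hu Hv.
have ab0 : 0 < a + b by rewrite addr_gt0.
apply: (@le_trans _ _ (int_pos (fun x =>
    (a + b) / a * (expR (2 * beta * x) * u x ^+ 2) +
    (a + b) / b * (expR (2 * beta * x) * v x ^+ 2)))).
  apply: int_pos_le.
  - by apply: cont_pos_weight; exact: cont_posD.
  - by apply: cont_posD; apply: cont_posM; [exact: cont_pos_cst|exact: cont_pos_weight|exact: cont_pos_cst|exact: cont_pos_weight].
  - by move=> x _; exact: (weight_ge0 beta (fun x => u x + v x)).
  - move=> x _; rewrite [X in _ <= X + _]mulrCA [X in _ <= _ + X]mulrCA -mulrDr.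
    rewrite ler_wpM2l ?expR_ge0//.
    rewrite -subr_ge0.
    suff -> : (a + b) / a * u x ^+ 2 + (a + b) / b * v x ^+ 2 - (u x + v x) ^+ 2
      = (b * u x - a * v x) ^+ 2 / (a * b).
      by rewrite mulr_ge0 ?sqr_ge0// invr_ge0 mulr_ge0 ?ltW.
    by field; apply/andP; split; lra.
have p1 : 0 <= (a + b) / a by rewrite divr_ge0 ?ltW.
have p2 : 0 <= (a + b) / b by rewrite divr_ge0 ?ltW.
rewrite int_posD.
- rewrite !int_posZ//; try exact: cont_pos_weight; try by move=> x _; exact: weight_ge0.
  rewrite (_ : (a + b) ^+ 2 = (a + b) / a * a ^+ 2 + (a + b) / b * b ^+ 2); last first.
    by field; apply/andP; split; lra.
  rewrite EFinD (EFinM ((a + b) / a)) (EFinM ((a + b) / b)).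
  by apply: leeD; apply: lee_wpmul2l; rewrite // lee_fin.
- by apply: cont_posM; [exact: cont_pos_cst|exact: cont_pos_weight].
- by apply: cont_posM; [exact: cont_pos_cst|exact: cont_pos_weight].
- by move=> x _; rewrite mulr_ge0// weight_ge0.
- by move=> x _; rewrite mulr_ge0// weight_ge0.
Qed.

(** A power of [x] is paid for by a slightly heavier exponential weight:
[x^k <= (k / d)^k exp (d x)], since [d x / k <= exp (d x / k)]. *)
Lemma wnorm_pow beta d u c k : cont_pos u -> 0 < d ->
  wnorm_le (beta + d) u c -> wnorm_le beta (fun x => x ^+ k * u x) ((k%:R / d) ^+ k * c).
Proof.
move=> cu d0; apply: wnorm_dom; first exact: cu.
- by apply: cont_posM => // x x0; exact: exprn_continuous.
- by rewrite exprn_ge0// divr_ge0 ?(ltW d0).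
move=> x x0; rewrite mulrDl expRD normrM [ `|x ^+ k|]ger0_norm ?exprn_ge0 ?(ltW x0)//.
rewrite -!mulrA [X in _ <= X]mulrCA ler_wpM2l ?expR_ge0// mulrA ler_wpM2r//.
case: k => [|k]; first by rewrite !expr0 mul1r -expR0 ler_expR mulr_ge0 ?(ltW x0) ?(ltW d0).
have -> : expR (d * x) = expR (d * x / k.+1%:R) ^+ k.+1.
  rewrite -expRM_natl; congr expR; field; by rewrite nat1r pnatr_eq0.
have k0 : 0 < k.+1%:R :> R by rewrite ltr0n.
have k0' : 0 < k.+1%:R / d by rewrite divr_gt0.
rewrite -exprMn; apply: lerXn2r; rewrite ?nnegrE; [exact: ltW| |].
  by rewrite mulr_ge0 ?expR_ge0// ltW.
have := expR_ge1Dx (d * x / k.+1%:R).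
set e := expR _ => He.
apply: (@le_trans _ _ (k.+1%:R / d * (d * x / k.+1%:R))); last first.
  rewrite ler_wpM2l ?(ltW k0')//. by apply: le_trans He; rewrite lerDr ler01.
by rewrite le_eqVlt; apply/orP; left; apply/eqP; field; rewrite nat1r pnatr_eq0 /= gt_eqF.
Qed.

Lemma wnorm_sum beta u0 c0 n (u : nat -> R -> R) (c : nat -> R) :
  cont_pos u0 -> (forall k, (k < n)%N -> cont_pos (u k)) ->
  0 < c0 -> (forall k, (k < n)%N -> 0 < c k) ->
  wnorm_le beta u0 c0 -> (forall k, (k < n)%N -> wnorm_le beta (u k) (c k)) ->
  cont_pos (fun x => u0 x + \sum_(k < n) u k x) /\
  wnorm_le beta (fun x => u0 x + \sum_(k < n) u k x) (c0 + \sum_(k < n) c k).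
Proof.
move=> cu0 + c00; elim: n => [|n IH] cu cp H0 H.
  rewrite big_ord0 addr0.
  suff -> : (fun x => u0 x + \sum_(k < 0) u k x) = u0 by split.
  by apply/funext => x; rewrite big_ord0 addr0.
have [C W] : cont_pos (fun x => u0 x + \sum_(k < n) u k x) /\
    wnorm_le beta (fun x => u0 x + \sum_(k < n) u k x) (c0 + \sum_(k < n) c k).
  by apply: IH => // k kn; [apply: cu|apply: cp|apply: H]; rewrite ltnS ltnW.
have -> : (fun x => u0 x + \sum_(k < n.+1) u k x) =
   (fun x => (u0 x + \sum_(k < n) u k x) + u n x).
  by apply/funext => x; rewrite big_ord_recr /= addrA.
rewrite big_ord_recr /= addrA.
have cun : cont_pos (u n) by exact: cu.
split; first exact: cont_posD.
apply: wnormD => //; [|exact: cp|exact: H].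
rewrite ltr_wpDr// sumr_ge0// => k _; rewrite ltW// cp//.
by rewrite ltnS ltnW.
Qed.

End Weighted.

(** * The energy estimate *)

Section Energy.
Context {R : realType}.
Implicit Types (x y b : R).

Lemma MVT_pos (G g : R -> R) y x : deriv_on pos G g -> 0 < y -> y < x ->
  exists c, [/\ y < c, c < x & G x - G y = g c * (x - y)].
Proof.
move=> dG y0 yx; have cG := deriv_on_cont_pos dG.
have [||c] := @MVT R G g y x yx.
- move=> z; rewrite in_itv /= => /andP[yz _].
  by apply: (deriv_on_pos _ _).1 => //; exact: lt_trans yz.
- exact: within_pos.
by rewrite in_itv /= => /andP[yc cx] E; exists c.
Qed.

(** A nonnegative function that vanishes at 0 cannot decrease all the way from
0: apply the mean value theorem between a point where it is positive and one
closer to 0 where it is smaller. The last hypothesis covers the zeros of [G]. *)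
Lemma derive_ge0_near0 (G g : R -> R) : deriv_on pos G g ->
  (forall x, 0 < x -> 0 <= G x) -> G x @[x --> 0^'+] --> 0 ->
  (forall x, 0 < x -> G x = 0 -> g x = 0) ->
  forall a, 0 < a -> exists x, [/\ 0 < x, x < a & 0 <= g x].
Proof.
move=> dG G0 G1 Gg a a0.
have h0 : 0 < a / 2 by lra.
have [E|N] := eqVneq (G (a / 2)) 0.
  by exists (a / 2); split=> //; [lra|rewrite Gg].
have Gp : 0 < G (a / 2) by rewrite lt_neqAle eq_sym N G0.
have H1 : \forall x \near (0 : R)^'+, G x < G (a / 2) by apply: cvgr_lt Gp.
have H2 : \forall x \near (0 : R)^'+, x < a / 2 by exact: nbhs_right_lt.
have H3 : \forall x \near (0 : R)^'+, 0 < x by exact: nbhs_right_gt.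
near (0 : R)^'+ => y.
have y1 : G y < G (a / 2) by near: y.
have y2 : y < a / 2 by near: y.
have y3 : 0 < y by near: y.
have [c [c1 c2 E]] := MVT_pos dG y3 y2.
exists c; split; [exact: lt_trans c1|lra|].
have : 0 < g c * (a / 2 - y) by rewrite -E subr_gt0.
by rewrite pmulr_lgt0 ?subr_gt0// => /ltW.
Unshelve. all: by end_near. Qed.

(** The mirror image at infinity of [derive_ge0_near0]. *)
Lemma derive_le0_nearoo (G g : R -> R) : deriv_on pos G g ->
  (forall x, 0 < x -> 0 <= G x) -> G x @[x --> +oo] --> 0 ->
  (forall x, 0 < x -> G x = 0 -> g x = 0) ->
  forall b, 0 < b -> exists x, b < x /\ g x <= 0.
Proof.
move=> dG G0 G1 Gg b b0.
have b10 : 0 < b + 1 by lra.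
have [E|N] := eqVneq (G (b + 1)) 0.
  by exists (b + 1); split=> //; [lra|rewrite Gg].
have Gp : 0 < G (b + 1) by rewrite lt_neqAle eq_sym N G0.
have H1 : \forall x \near +oo, G x < G (b + 1) by apply: cvgr_lt Gp.
have H2 : \forall x \near +oo, b + 1 < x by apply: nbhs_pinfty_gt; rewrite num_real.
near (pinfty_nbhs R) => y.
have y1 : G y < G (b + 1) by near: y.
have y2 : b + 1 < y by near: y.
have [c [c1 c2 E]] := MVT_pos dG b10 y2.
exists c; split; [lra|].
have : g c * (y - (b + 1)) < 0 by rewrite -E subr_lt0.
by rewrite pmulr_llt0 ?subr_gt0// => /ltW.
Unshelve. all: by end_near. Qed.

(** Here [e = nu^2]; [(p, q)], [(p', q')] and [(r, s)] stand for the values of [V],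
[V'] and [F], and [ap] for [V . A(0) V]. Young's inequality with parameter
[alpha] absorbs the cross term [2 beta V . E V'] into [beta / alpha] of
[V' . E V'] and [alpha beta] of [|V|^2]; the rest is a sum of squares. *)
Lemma energy_pointwise (al be e p q p' q' r s : R) : 0 < be -> be < al ->
  0 <= e -> e <= 1 ->
  forall ap : R, al ^+ 2 * (p ^+ 2 + q ^+ 2) <= ap ->
  (al - be) / al * (e * p' ^+ 2 + q' ^+ 2) + al * (al - be) / 2 * (p ^+ 2 + q ^+ 2)
  <= 2 * be * (e * (p * p') + q * q') + (e * p' ^+ 2 + q' ^+ 2) + (ap - (p * r + q * s))
    + (r ^+ 2 + s ^+ 2) / (2 * al * (al - be)).
Proof.
move=> b0 ba e0 e1 ap Hap.
have al0 : 0 < al by lra.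
have D0 : 0 < al - be by lra.
have aD0 : 0 < 2 * al * (al - be) by rewrite !mulr_gt0.
have bal0 : 0 <= be / al by rewrite divr_ge0 ?ltW.
have h1 : 0 <= e * (be / al * (p' + al * p) ^+ 2).
  by rewrite mulr_ge0// mulr_ge0 ?sqr_ge0.
have h2 : 0 <= be / al * (q' + al * q) ^+ 2.
  by rewrite mulr_ge0 ?sqr_ge0.
have h3 : 0 <= ((al * (al - be) * p - r) ^+ 2 + (al * (al - be) * q - s) ^+ 2) / (2 * al * (al - be)).
  by rewrite divr_ge0 ?addr_ge0 ?sqr_ge0 ?(ltW aD0).
have h4 : 0 <= al * be * (1 - e) * p ^+ 2.
  apply: mulr_ge0 (sqr_ge0 p).
  by apply: mulr_ge0; [apply: mulr_ge0; exact: ltW|rewrite subr_ge0].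
rewrite -subr_ge0.
suff -> : 2 * be * (e * (p * p') + q * q') + (e * p' ^+ 2 + q' ^+ 2) + (ap - (p * r + q * s))
    + (r ^+ 2 + s ^+ 2) / (2 * al * (al - be)) -
  ((al - be) / al * (e * p' ^+ 2 + q' ^+ 2) + al * (al - be) / 2 * (p ^+ 2 + q ^+ 2))
  = (ap - al ^+ 2 * (p ^+ 2 + q ^+ 2)) + e * (be / al * (p' + al * p) ^+ 2)
   + be / al * (q' + al * q) ^+ 2 + al * be * (1 - e) * p ^+ 2
   + ((al * (al - be) * p - r) ^+ 2 + (al * (al - be) * q - s) ^+ 2) / (2 * al * (al - be)).
  have : 0 <= ap - al ^+ 2 * (p ^+ 2 + q ^+ 2) by rewrite subr_ge0.
  lra.
by field; apply/andP; split; lra.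
Qed.

Variables (alpha beta nu M : R) (a : 'I_2 -> 'I_2 -> R).
Hypotheses (beta0 : 0 < beta) (betaalpha : beta < alpha)
  (nu0 : 0 < nu) (nu1 : nu <= 1) (Hco : coercive2 alpha a).
Variables (V V1 V2 F : 'I_2 -> R -> R).
Hypotheses (dV : forall j, deriv_on pos (V j) (V1 j))
  (dV1 : forall j, deriv_on pos (V1 j) (V2 j))
  (cV2 : forall j, cont_pos (V2 j))
  (cF : forall j, cont_pos (F j))
  (EqV : forall x, 0 < x -> forall j,
     - (Emx_entry nu j * V2 j x) + \sum_l a j l * V l x = F j x)
  (V00 : forall j, V j x @[x --> 0^'+] --> 0)
  (Voo : forall j, V j x @[x --> +oo] --> 0)
  (FM : forall j, wnorm_le beta (F j) M).

Let e := nu ^+ 2.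
Let Q x : R := (e * V 0 x * V 0 x + V 1 x * V 1 x) / 2.
Let Q1 x : R := e * (V 0 x * V1 0 x) + V 1 x * V1 1 x.
Let Q2 x : R := e * (V1 0 x * V1 0 x + V 0 x * V2 0 x) + (V1 1 x * V1 1 x + V 1 x * V2 1 x).

Lemma deriv_onZ (f f' : R -> R) (c : R) : deriv_on pos f f' ->
  deriv_on pos (fun x => c * f x) (fun x => c * f' x).
Proof.
move=> H; have := deriv_onM (@deriv_on_cst _ pos c) H.
by apply: deriv_on_ext => x _ //=; rewrite mul0r add0r.
Qed.

Let dQ : deriv_on pos Q Q1.
Proof.
have := deriv_onD (deriv_onZ (c := e / 2) (deriv_onM (@dV 0) (@dV 0))) (deriv_onZ (c := 2^-1) (deriv_onM (@dV 1) (@dV 1))).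
by apply: deriv_on_ext => x _ /=; rewrite /Q /Q1; field.
Qed.

Let dQ1 : deriv_on pos Q1 Q2.
Proof.
have := deriv_onD (deriv_onZ (c := e) (deriv_onM (@dV 0) (@dV1 0))) (deriv_onM (@dV 1) (@dV1 1)).
by apply: deriv_on_ext => x _ /=; rewrite /Q1 /Q2.
Qed.

Let w x : R := expR (2 * beta * x).

Let cw : cont_pos w. Proof. exact: cont_pos_expR. Qed.

Let dG : deriv_on pos (fun x => w x * Q1 x)
   (fun x => (2 * beta) * w x * Q1 x + w x * Q2 x).
Proof.
have := deriv_onM (@deriv_on_expR R (2 * beta)) dQ1.
by apply: deriv_on_ext => x _ /=; rewrite /w.
Qed.

Let e0 : 0 < e. Proof. exact: exprn_gt0. Qed.
Let e1 : e <= 1. Proof. by rewrite exprn_ile1// ltW. Qed.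

Let cV j : cont_pos (V j). Proof. exact: deriv_on_cont_pos (@dV j). Qed.
Let cV1 j : cont_pos (V1 j). Proof. exact: deriv_on_cont_pos (@dV1 j). Qed.

Let Q_ge0 x : 0 <= Q x.
Proof.
rewrite divr_ge0// addr_ge0 -?expr2 ?sqr_ge0//.
by rewrite -mulrA -expr2 mulr_ge0 ?sqr_ge0// ltW.
Qed.

Let Q_eq0 x : Q x = 0 -> Q1 x = 0.
Proof.
move=> H.
have h1 : 0 <= e * V 0 x * V 0 x by rewrite -mulrA -expr2 mulr_ge0 ?sqr_ge0// ltW.
have h2 : 0 <= V 1 x * V 1 x by rewrite -expr2 sqr_ge0.
have {}H : e * V 0 x * V 0 x + V 1 x * V 1 x = 0 by move: H; rewrite /Q; lra.
have z0 : V 0 x = 0.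
  have : e * V 0 x * V 0 x = 0 by lra.
  by move/eqP; rewrite !mulf_eq0 gt_eqF//= orbb => /eqP.
have z1 : V 1 x = 0.
  have : V 1 x * V 1 x = 0 by lra.
  by move/eqP; rewrite mulf_eq0 orbb => /eqP.
by rewrite /Q1 z0 z1 !mul0r mulr0 addr0.
Qed.

Lemma cvg_Q (T : set_system R) (FT : Filter T) :
  (forall j, V j x @[x --> T] --> 0) -> Q x @[x --> T] --> 0.
Proof.
move=> H.
have : (e * (V 0 x * V 0 x) + V 1 x * V 1 x) / 2 @[x --> T] --> (e * (0 * 0) + 0 * 0) / 2.
  apply: cvgM; last exact: cvg_cst.
  apply: cvgD; [apply: cvgM; [exact: cvg_cst|]|]; exact: cvgM.
rewrite !mulr0 addr0 mul0r; apply: cvg_trans; apply: near_eq_cvg.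
by apply: nearW => x; rewrite /Q mulrA.
Qed.

Let D := alpha - beta.

(** Integrate [energy_pointwise]. The boundary terms are weighted values
of [Q'], which have the right sign at suitable points close to 0 and far away. *)
Lemma energy_le :
  (int_pos (fun x => D / alpha * (e * (w x * V1 0 x ^+ 2) + w x * V1 1 x ^+ 2)
     + alpha * D / 2 * (w x * V 0 x ^+ 2 + w x * V 1 x ^+ 2))%R
   <= (M ^+ 2 / (alpha * D))%:E)%E.
Proof.
have al0 : 0 < alpha by exact: lt_trans betaalpha.
have D0 : 0 < D by rewrite subr_gt0.
pose k x : R := (2 * alpha * D)^-1 * (w x * F 0 x ^+ 2 + w x * F 1 x ^+ 2).
have w0 x : 0 < w x by exact: expR_gt0.
have cF2 j : cont_pos (fun x => w x * F j x ^+ 2) by apply: cont_pos_weight.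
have cVV j : cont_pos (fun x => w x * V j x ^+ 2) by apply: cont_pos_weight.
have cVV1 j : cont_pos (fun x => w x * V1 j x ^+ 2) by apply: cont_pos_weight.
have aD0 : 0 < (2 * alpha * D)^-1 by rewrite invr_gt0 !mulr_gt0.
rewrite -[M ^+ 2 / _]add0r.
apply: (@int_pos_le_primitive _ _ k (fun x => w x * Q1 x)
   (fun x => (2 * beta) * w x * Q1 x + w x * Q2 x)).
- apply: cont_posD; apply: cont_posM; try exact: cont_pos_cst; apply: cont_posD => //.
  by apply: cont_posM => //; exact: cont_pos_cst.
- apply: cont_posM; first exact: cont_pos_cst.
  exact: cont_posD.
- have cQ1 := deriv_on_cont_pos dQ1.
  have cQ2 : cont_pos Q2.
    apply: cont_posD; [apply: cont_posM; [exact: cont_pos_cst|]|];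
      apply: cont_posD; exact: cont_posM.
  by apply: cont_posD; apply: cont_posM => //; apply: cont_posM => //; exact: cont_pos_cst.
- exact: dG.
- move=> x x0; apply: addr_ge0.
    apply: mulr_ge0; first by rewrite divr_ge0 ?ltW.
    apply: addr_ge0; last exact: weight_ge0.
    by apply: mulr_ge0; [exact: ltW|exact: weight_ge0].
  apply: mulr_ge0; first by rewrite divr_ge0// mulr_ge0 ?ltW.
  by apply: addr_ge0; exact: weight_ge0.
- move=> x x0; rewrite /k; apply: mulr_ge0; first exact: ltW.
  by apply: addr_ge0; exact: weight_ge0.
- move=> x x0.
  have E0 : e * V2 0 x = \sum_l a 0 l * V l x - F 0 x.
    by have := EqV x0 0; rewrite /Emx_entry eqxx -/e; lra.
  have E1 : V2 1 x = \sum_l a 1 l * V l x - F 1 x.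
    by have := EqV x0 1; rewrite /Emx_entry /=; lra.
  have Hc := Hco (fun j => V j x); rewrite [in X in _ * X <= _]sum_ord2 [X in _ <= X]sum_ord2 in Hc.
  have := energy_pointwise (V1 0 x) (V1 1 x) (F 0 x) (F 1 x) beta0 betaalpha (ltW e0) e1 Hc.
  rewrite -/D -(ler_pM2l (w0 x)); set L1 := (X in X <= _); set R1 := (X in _ <= X) => H.
  have -> : D / alpha * (e * (w x * V1 0 x ^+ 2) + w x * V1 1 x ^+ 2) +
    alpha * D / 2 * (w x * V 0 x ^+ 2 + w x * V 1 x ^+ 2) = L1 by rewrite /L1; ring.
  apply: le_trans H _; rewrite le_eqVlt; apply/orP; left; apply/eqP.
  rewrite /R1 /k /Q1 /Q2.
  have -> : e * (V1 0 x * V1 0 x + V 0 x * V2 0 x) =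
     e * (V1 0 x * V1 0 x) + V 0 x * (e * V2 0 x) by ring.
  by rewrite E0 E1; ring.
- move=> a0 b0 a00.
  (* [Q' >= 0] at [x] near 0 and [Q' <= 0] at [y] far away. *)
  have [x [x0 xa g0]] := derive_ge0_near0 dQ (fun x _ => Q_ge0 x) (cvg_Q _ V00)
    (fun x _ => @Q_eq0 x) a00.
  have [|y [by_ y0]] := @derive_le0_nearoo _ _ dQ (fun x _ => Q_ge0 x) (cvg_Q _ Voo)
    (fun x _ => @Q_eq0 x) (`|b0| + 1); first by rewrite ltr_wpDl.
  exists x, y; split => //.
    by have := ler_norm b0; lra.
  rewrite subr_le0; apply: (@le_trans _ _ 0).
    by rewrite mulr_ge0_le0 ?(ltW (w0 y)).
  by rewrite mulr_ge0 ?(ltW (w0 x)).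
- rewrite int_posZ; [|exact: cont_posD| |exact: ltW]; last first.
    by move=> x _; rewrite addr_ge0 ?weight_ge0.
  rewrite int_posD//; [|by move=> x _; exact: weight_ge0|by move=> x _; exact: weight_ge0].
  have -> : M ^+ 2 / (alpha * D) = (2 * alpha * D)^-1 * (M ^+ 2 + M ^+ 2).
    by field; apply/andP; split; rewrite gt_eqF.
  rewrite (EFinM (2 * alpha * D)^-1); apply: lee_wpmul2l; first by rewrite lee_fin ltW.
  by rewrite EFinD; apply: leeD; exact: FM.
Qed.

(** The two estimates contained in [energy_le], component by component. The
first component of [V'] carries the factor [nu^2] in the energy, which costs
[1 / nu]. *)
Lemma energy_bound j :
  wnorm_le beta (V j) (2 / alpha * D^-1 * M) /\
  wnorm_le beta (V1 j) (nu^-1 * (D^-1 * M)).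
Proof.
have al0 : 0 < alpha by exact: lt_trans betaalpha.
have D0 : 0 < D by rewrite subr_gt0.
have w0 x : 0 < w x by exact: expR_gt0.
have cVV j' : cont_pos (fun x => w x * V j' x ^+ 2) by apply: cont_pos_weight.
have cVV1 j' : cont_pos (fun x => w x * V1 j' x ^+ 2) by apply: cont_pos_weight.
have p1 : 0 < alpha * D / 2 by rewrite !mulr_gt0.
have p2 : 0 < D / alpha by rewrite divr_gt0.
pose H x : R := D / alpha * (e * (w x * V1 0 x ^+ 2) + w x * V1 1 x ^+ 2)
     + alpha * D / 2 * (w x * V 0 x ^+ 2 + w x * V 1 x ^+ 2).
have cH : cont_pos H.
  apply: cont_posD; apply: cont_posM; try exact: cont_pos_cst; apply: cont_posD => //.
  by apply: cont_posM => //; exact: cont_pos_cst.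
have key (u : R -> R) (c : R) B : 0 < c -> cont_pos u ->
   (forall x, 0 < x -> c * (w x * u x ^+ 2) <= H x) ->
   M ^+ 2 / (alpha * D) <= c * B ^+ 2 -> wnorm_le beta u B.
  move=> c0 cu uH MB; rewrite /wnorm_le.
  have cw2 : cont_pos (fun x => w x * u x ^+ 2) by apply: cont_pos_weight.
  suff : (c%:E * int_pos (fun x => w x * u x ^+ 2)%R <= c%:E * (B ^+ 2)%:E)%E.
    by rewrite lee_pmul2l// lte_fin.
  rewrite -int_posZ//; [|by move=> x _; exact: weight_ge0|exact: ltW].
  apply: (@le_trans _ _ (int_pos H)).
    apply: int_pos_le => //.
      by apply: cont_posM => //; exact: cont_pos_cst.
    by move=> x _; rewrite mulr_ge0 ?weight_ge0// ltW.
  by apply: le_trans energy_le _; rewrite -EFinM lee_fin.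
have X1 x : 0 <= D / alpha * (e * (w x * V1 0 x ^+ 2)).
  by rewrite mulr_ge0 ?(ltW p2)// mulr_ge0 ?(ltW e0)// weight_ge0.
have X2 x : 0 <= D / alpha * (w x * V1 1 x ^+ 2).
  by rewrite mulr_ge0 ?(ltW p2)// weight_ge0.
have X3 x i : 0 <= alpha * D / 2 * (w x * V i x ^+ 2).
  by rewrite mulr_ge0 ?(ltW p1)// weight_ge0.
split.
  apply: (key _ _ _ p1) => //.
    move=> x x0; have := X1 x; have := X2 x; have := X3 x 0; have := X3 x 1.
    rewrite /H !mulrDr; move: j; apply: ord2_ind; lra.
  rewrite -subr_ge0.
  have -> : alpha * D / 2 * (2 / alpha * D^-1 * M) ^+ 2 - M ^+ 2 / (alpha * D) = M ^+ 2 / (alpha * D).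
    by field; apply/andP; split; rewrite gt_eqF.
  by rewrite divr_ge0 ?sqr_ge0// mulr_ge0// ltW.
apply: (key _ (D / alpha * e)) => //.
- by rewrite mulr_gt0.
- move=> x x0; have := X1 x; have := X2 x; have := X3 x 0; have := X3 x 1.
  rewrite /H !mulrDr; move: j; apply: ord2_ind; first by rewrite -mulrA; lra.
  suff : D / alpha * e * (w x * V1 1 x ^+ 2) <= D / alpha * (w x * V1 1 x ^+ 2) by lra.
  by rewrite -mulrA ler_wpM2l ?(ltW p2)// ler_piMl ?weight_ge0.
- rewrite le_eqVlt; apply/orP; left; apply/eqP; rewrite /e.
  by field; rewrite !gt_eqF.
Qed.

End Energy.

(** * The inner equations, differentiated *)

Section DerivPos.
Context {R : realType}.
Implicit Types (x y b : R) (u v : R -> R).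

Lemma derive_pos u v x : deriv_on pos u v -> 0 < x -> derive_within pos u x = v x.
Proof. by move=> H x0; exact: (deriv_on_derive perfect_pos H). Qed.

Lemma deriven_pos_ext n u v : (forall x, 0 < x -> u x = v x) ->
  forall x, 0 < x -> deriven_within pos n u x = deriven_within pos n v x.
Proof. by move=> uv x x0; apply: deriven_within_ext; rewrite ?inE// => z /set_mem; exact: uv. Qed.

Lemma deriven_deriv_on u n : smooth_on pos u ->
  deriv_on pos (deriven_within pos n u) (deriven_within pos n.+1 u).
Proof. by move=> su; exact: (@smooth_on_deriv_on _ _ perfect_pos _ n su). Qed.

Lemma smoothD u v : smooth_on (@pos R) u -> smooth_on pos v -> smooth_on pos (fun x => u x + v x).
Proof. by move=> su sv n; exact: (diff_classD (su n) (sv n)). Qed.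

Lemma smoothM u v : smooth_on (@pos R) u -> smooth_on pos v -> smooth_on pos (fun x => u x * v x).
Proof. by move=> su sv n; exact: (diff_classM (su n) (sv n)). Qed.

Lemma smooth_cst (c : R) : smooth_on (@pos R) (fun=> c).
Proof. by move=> n; exact: diff_class_cst. Qed.

Lemma smoothZ u c : smooth_on (@pos R) u -> smooth_on pos (fun x => c * u x).
Proof. by move=> su; apply: smoothM => //; exact: smooth_cst. Qed.

Lemma smooth_pow k : smooth_on (@pos R) (fun x => x ^+ k).
Proof.
elim: k => [|k IH n]; first exact: smooth_cst.
apply: diff_class_ext (diff_classM (@diff_class_id _ pos n) (IH n)) => x _ /=.
by rewrite exprS.
Qed.

Lemma derivenD n u v : smooth_on pos u -> smooth_on pos v -> forall x, 0 < x ->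
  deriven_within pos n (fun x => u x + v x) x =
  deriven_within pos n u x + deriven_within pos n v x.
Proof.
move=> su sv; elim: n => [//|n IH] x x0 /=.
apply: (@derive_pos _ (fun x => deriven_within pos n.+1 u x + deriven_within pos n.+1 v x)) => //.
apply: deriv_on_ext (deriv_onD (@deriven_deriv_on _ n su) (@deriven_deriv_on _ n sv)) => // z /set_mem z0 /=.
by rewrite IH.
Qed.

Lemma derivenZ n u c : smooth_on pos u -> forall x, 0 < x ->
  deriven_within pos n (fun x => c * u x) x = c * deriven_within pos n u x.
Proof.
move=> su; elim: n => [//|n IH] x x0 /=.
apply: (@derive_pos _ (fun x => c * deriven_within pos n.+1 u x)) => //.
apply: deriv_on_ext (deriv_onZ (c := c) (@deriven_deriv_on _ n su)) => // z /set_mem z0 /=.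
by rewrite IH.
Qed.

Lemma deriven_sum n (I : Type) (r : seq I) (F : I -> R -> R) :
  (forall i, smooth_on pos (F i)) -> forall x, 0 < x ->
  deriven_within pos n (fun x => \sum_(i <- r) F i x) x =
  \sum_(i <- r) deriven_within pos n (F i) x.
Proof.
move=> sF; elim: r => [|i r IH] x x0.
  rewrite big_nil (@deriven_pos_ext n _ (fun x => 0 * (cst 0 x : R)))//.
    by rewrite (@derivenZ n (cst 0) 0) ?mul0r//; exact: smooth_cst.
  by move=> z _; rewrite big_nil mul0r.
rewrite big_cons -IH// -derivenD//; last exact: smooth_on_sum.
by apply: deriven_pos_ext => // z _; rewrite big_cons.
Qed.

(** Leibniz' formula for one factor [x]; higher powers of [x] are treated one
factor at a time. *)
Lemma derivenX n u : smooth_on pos u -> forall x, 0 < x ->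
  deriven_within pos n (fun x => x * u x) x =
  x * deriven_within pos n u x + n%:R * deriven_within pos n.-1 u x.
Proof.
move=> su; elim: n => [|n IH] x x0; first by rewrite /= mul0r addr0.
rewrite [LHS]/=; apply: (@derive_pos _ (fun x => x * deriven_within pos n.+1 u x +
  n.+1%:R * deriven_within pos n u x)) => //.
have dx := deriv_onM (@deriv_on_id _ pos) (@deriven_deriv_on _ n su).
case: n IH dx => [|n] IH dx.
  apply: deriv_on_ext dx => z /set_mem z0 //=; ring.
apply: deriv_on_ext (deriv_onD dx (deriv_onZ (c := n.+1%:R) (@deriven_deriv_on _ n su))) => z /set_mem z0.
  by rewrite IH.
by rewrite /cst [in RHS]/= -[in RHS]nat1r /=; ring.
Qed.

Lemma wnorm_ext beta u v (c : R) : (forall x, 0 < x -> u x = v x) ->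
  wnorm_le beta u c -> wnorm_le beta v c.
Proof.
move=> uv; rewrite /wnorm_le /int_pos; congr (_ <= _)%E.
by apply: eq_integral => x /set_mem; rewrite mem_halfline => x0; rewrite uv.
Qed.

End DerivPos.

Section Inner.
Context {R : realType}.
Variables (nu : R) (A : R -> 'M[R]_2) (U W : nat -> R -> 'cV[R]_2).
Hypotheses (nu0 : 0 < nu) (HW : is_inner nu A U W).

Definition inner_entry i j : R -> R := fun x => W i x j 0.
Definition inner_entry1 i j : R -> R := fun x => derive1 (W i) x j 0.
Definition inner_entry2 i j : R -> R := fun x => derive1n 2 (W i) x j 0.

Lemma deriv_on_inner i j : deriv_on pos (inner_entry i j) (inner_entry1 i j).
Proof.
apply: deriv_on_pos_mx => x x0.
by have [+ _ _ _] := HW i => /(_ x x0)[].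
Qed.

Lemma deriv_on_inner1 i j : deriv_on pos (inner_entry1 i j) (inner_entry2 i j).
Proof.
apply: (@deriv_on_pos_mx _ _ _ (derive1 (W i)) j 0) => x x0.
by have [+ _ _ _] := HW i => /(_ x x0)[].
Qed.

Lemma Emx_entry_gt0 j : 0 < Emx_entry nu j.
Proof. by rewrite /Emx_entry; case: ifP => // _; rewrite exprn_gt0. Qed.

Lemma inner_eq i x : 0 < x -> forall j,
  - (Emx_entry nu j * inner_entry2 i j x) + \sum_l A 0 j l * inner_entry i l x =
  - \sum_(n < i) \sum_l Acoef A (i - n) j l * (x ^+ (i - n) * inner_entry n l x).
Proof.
move=> x0 j; have [+ _ _ _] := HW i => /(_ x x0)[_ _].
move=> /(congr1 (fun M : 'cV[R]_2 => M j 0)).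
rewrite [LHS]mxE [in RHS]mxE summxE mxE Emx_mul => E.
transitivity (- (Emx_entry nu j * derive1n 2 (W i) x j 0) + (A 0 *m W i x) j 0).
  by congr (_ + _); rewrite mxE.
rewrite E; congr (- _); apply: eq_bigr => n _.
rewrite !mxE mulr_sumr; apply: eq_bigr => l _.
by rewrite mulrCA.
Qed.

(** The second derivative is [E^-1] times this, by the inner equation. *)
Definition inner_forcing i j : R -> R := fun x =>
  \sum_l A 0 j l * inner_entry i l x +
  \sum_(n < i) \sum_l Acoef A (i - n) j l * (x ^+ (i - n) * inner_entry n l x).

Lemma inner_entry2E i j x : 0 < x ->
  inner_entry2 i j x = (Emx_entry nu j)^-1 * inner_forcing i j x.
Proof.
move=> x0; have E0 := Emx_entry_gt0 j.
apply: (mulfI (lt0r_neq0 E0)); rewrite mulVKf ?lt0r_neq0// /inner_forcing.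
have := inner_eq i x0 j; lra.
Qed.

(** The equation gives each function two more derivatives than its right hand
side, so smoothness is gained two orders at a time. *)
Lemma smooth_inner i j : smooth_on pos (inner_entry i j).
Proof.
elim/ltn_ind: i j => i IH.
have sS j : smooth_on pos (fun x =>
   \sum_(n < i) \sum_l Acoef A (i - n) j l * (x ^+ (i - n) * inner_entry n l x)).
  apply: smooth_on_sum => n; apply: smooth_on_sum => l.
  by apply: smoothZ; apply: smoothM; [exact: smooth_pow|exact: IH].
suff H n : forall j, diff_class pos n (inner_entry i j) /\ diff_class pos n.+1 (inner_entry i j).
  by move=> j n; case: (H n j).
elim: n => [|n IHn] j.
  by split=> //; exists (inner_entry1 i j) => //; exact: deriv_on_inner.
split; first by case: (IHn j).
exists (inner_entry1 i j); first exact: deriv_on_inner.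
exists (inner_entry2 i j); first exact: deriv_on_inner1.
have s0 l : diff_class pos n (inner_entry i l) by case: (IHn l).
have s1 l := diff_classM (@diff_class_cst _ pos n (A 0 j l)) (s0 l).
have := diff_classM (@diff_class_cst _ pos n (Emx_entry nu j)^-1)
   (diff_classD (diff_classD (s1 0) (s1 1)) (sS j n)).
apply: diff_class_ext => x /set_mem x0 /=.
by rewrite inner_entry2E// /inner_forcing [in RHS]sum_ord2.
Qed.

Definition inner_deriv i m j : R -> R := deriven_within pos m (inner_entry i j).

Lemma inner_deriv_deriv_on i m j : deriv_on pos (inner_deriv i m j) (inner_deriv i m.+1 j).
Proof. exact: deriven_deriv_on (smooth_inner i j). Qed.

Lemma cont_inner_deriv i m j : cont_pos (inner_deriv i m j).
Proof. exact: deriv_on_cont_pos (@inner_deriv_deriv_on i m j). Qed.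

Lemma inner_deriv1 i j x : 0 < x -> inner_deriv i 1 j x = inner_entry1 i j x.
Proof. by move=> x0; exact: (derive_pos (@deriv_on_inner i j)). Qed.

Lemma inner_deriv2 i j x : 0 < x -> inner_deriv i 2 j x = inner_entry2 i j x.
Proof.
move=> x0; apply: derive_pos => //.
apply: deriv_on_ext (@deriv_on_inner1 i j) => z /set_mem z0 //.
by rewrite -inner_deriv1.
Qed.

(** Trades two derivatives for the factor [E^-1], that is [nu^(-2)], by
differentiating the inner equation. *)
Lemma inner_derivSS i p j x : 0 < x ->
  inner_deriv i p.+2 j x = (Emx_entry nu j)^-1 *
    (\sum_l A 0 j l * inner_deriv i p l x + \sum_(n < i) \sum_l
      Acoef A (i - n) j l *
       deriven_within pos p (fun x => x ^+ (i - n) * inner_entry n l x) x).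
Proof.
move=> x0.
have -> : inner_deriv i p.+2 j x = deriven_within pos p (inner_deriv i 2 j) x.
  by rewrite /inner_deriv /deriven_within -iterD addn2.
rewrite (@deriven_pos_ext _ p _ (fun x => (Emx_entry nu j)^-1 * inner_forcing i j x))//; last first.
  by move=> z z0; rewrite inner_deriv2// inner_entry2E.
have sx n l : smooth_on pos (fun x => x ^+ (i - n) * inner_entry n l x).
  by apply: smoothM; [exact: smooth_pow|exact: smooth_inner].
have s1 : smooth_on pos (fun x => \sum_l A 0 j l * inner_entry i l x).
  by apply: smooth_on_sum => l; apply: smoothZ; exact: smooth_inner.
have s2 n : smooth_on pos (fun x =>
    \sum_l Acoef A (i - n) j l * (x ^+ (i - n) * inner_entry n l x)).
  by apply: smooth_on_sum => l; exact: smoothZ.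
have s3 : smooth_on pos (fun x => \sum_(n < i)
    \sum_l Acoef A (i - n) j l * (x ^+ (i - n) * inner_entry n l x)).
  by apply: smooth_on_sum => n; exact: s2.
rewrite derivenZ//; last exact: smoothD.
rewrite derivenD//; congr (_ * (_ + _)).
  rewrite deriven_sum//; last by move=> l; apply: smoothZ; exact: smooth_inner.
  by apply: eq_bigr => l _; rewrite derivenZ//; exact: smooth_inner.
rewrite deriven_sum//; apply: eq_bigr => n _.
rewrite deriven_sum//; last by move=> l; exact: smoothZ.
by apply: eq_bigr => l _; rewrite derivenZ.
Qed.

Lemma derive1n_inner i m x : 0 < x -> derivable (derive1n m (W i)) x 1 /\
  forall j, derive1n m (W i) x j 0 = inner_deriv i m j x.
Proof.
move=> x0.
have s j k : smooth_on pos (fun x => W i x j k) by rewrite (ord1 k); exact: smooth_inner.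
by have [H1 H2] := derive1n_mx s m x0; split.
Qed.

End Inner.

(** * The forcing of the inner equations *)

Section Recursion.
Context {R : realType}.

Lemma exprV_gt0 (D : R) n : 0 < D -> 0 < D^-1 ^+ n.
Proof. by move=> D0; rewrite exprn_gt0// invr_gt0. Qed.

Lemma exprV_ge0 (D : R) n : 0 < D -> 0 <= D^-1 ^+ n.
Proof. by move=> D0; exact/ltW/exprV_gt0. Qed.

(** The bound of the theorem with [s] in place of [i + m] and [Y] in place of
[K2 / nu]; keeping [s] free lets one compare all the terms of a forcing at the
same [s]. *)
Definition layer_bound (C K1 Y s D : R) (n m : nat) : R :=
  C * D^-1 ^+ (2 * n + 1 + m) * s ^+ n * K1 ^+ n * Y ^+ m.

(** The loss from moving the weight closer to the critical one stays
exponential in the power [a] of [x] that is being absorbed, whatever the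
exponent [N <= 2 s]: [1 / (1 - k) <= exp (2 k)] for [k <= 1/2]. *)
Lemma shift_power (a s N : nat) : (0 < a)%N -> (a <= s)%N -> (N <= 2 * s)%N ->
  (1 - a%:R / (2 * s%:R))^-1 ^+ N <= expR 2 ^+ a :> R.
Proof.
move=> a0 as_ Ns.
have a0R : 0 < a%:R :> R by rewrite ltr0n.
have s0R : 0 < s%:R :> R by rewrite ltr0n (leq_trans a0).
have aR : a%:R <= s%:R :> R by rewrite ler_nat.
pose k : R := a%:R / (2 * s%:R).
have k0 : 0 < k by rewrite divr_gt0// mulr_gt0.
have k1 : k <= 2^-1 by rewrite ler_pdivrMr ?mulr_gt0//; lra.
have h1 : 0 < 1 - k by lra.
have h2 : (1 - k)^-1 <= expR (2 * k).
  apply: le_trans (expR_ge1Dx (2 * k)).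
  rewrite -(ler_pM2l h1) divff ?gt_eqF//; nra.
apply: (@le_trans _ _ (expR (2 * k) ^+ N)).
  by apply: lerXn2r; rewrite ?nnegrE ?expR_ge0// invr_ge0 ltW.
rewrite -!expRM_natl ler_expR.
have -> : a%:R * 2 = (2 * s%:R) * (2 * k) by rewrite /k; field; rewrite gt_eqF.
by rewrite ler_wpM2r ?mulr_ge0 ?(ltW k0)// -natrM ler_nat.
Qed.

Variables (alpha C K1 Y Z : R) (w : nat -> 'I_2 -> R -> R) (i p : nat).
Hypotheses (alpha0 : 0 < alpha) (C0 : 0 < C) (K10 : 0 < K1) (Y1 : 1 <= Y)
  (Z1 : 2 * expR 2 <= Z) (Z2 : alpha ^+ 2 <= Z)
  (sw : forall n l, smooth_on pos (w n l)).

Let S : R := (i + p)%:R.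

Hypothesis IH : forall n, (n < i)%N -> forall beta m l, 0 < beta -> beta < alpha ->
  wnorm_le beta (deriven_within pos m (w n l))
    (layer_bound C K1 Y (n + m)%:R (alpha - beta) n m).

Let Y0 : 0 < Y. Proof. by apply: lt_le_trans Y1. Qed.
Let Z0 : 0 < Z. Proof. by apply: lt_le_trans Z1; rewrite mulr_gt0 ?expR_gt0. Qed.

Lemma layer_bound_ge0 s D n m : 0 <= s -> 0 < D -> 0 <= layer_bound C K1 Y s D n m.
Proof.
by move=> s0 D0; rewrite /layer_bound !mulr_ge0 ?exprn_ge0 ?invr_ge0 ?(ltW C0) ?(ltW K10) ?(ltW Y0) ?(ltW D0).
Qed.

Lemma layer_bound_gt0 s D n m : 0 < s -> 0 < D -> 0 < layer_bound C K1 Y s D n m.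
Proof.
by move=> s0 D0; rewrite /layer_bound !mulr_gt0 ?exprn_gt0 ?invr_gt0.
Qed.

Lemma layer_bound_le s s' D n m : 0 <= s -> s <= s' -> 0 < D ->
  layer_bound C K1 Y s D n m <= layer_bound C K1 Y s' D n m.
Proof.
move=> s0 ss D0; rewrite /layer_bound.
rewrite ler_wpM2r ?exprn_ge0 ?(ltW Y0)// ler_wpM2r ?exprn_ge0 ?(ltW K10)//.
rewrite ler_wpM2l//; last by apply: lerXn2r; rewrite ?nnegrE// (le_trans s0).
by rewrite mulr_ge0 ?exprn_ge0 ?invr_ge0 ?(ltW C0) ?(ltW D0).
Qed.

Variables (beta : R).
Hypotheses (beta0 : 0 < beta) (betaalpha : beta < alpha).
Let D := alpha - beta.
Let D0 : 0 < D. Proof. by rewrite subr_gt0. Qed.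

(** The weight is shifted by [a D / (2 S)]. The power of [x] costs
[(2 S / D)^a] and the bound for the shifted weight [exp (2 a)], which together
are at most [(Z S / D)^a]. *)
Lemma wnorm_pow_deriv n q a l : (n < i)%N -> (q <= p)%N -> (a <= i - n)%N ->
  wnorm_le beta (fun x => x ^+ a * deriven_within pos q (w n l) x)
    ((Z * S / D) ^+ a * layer_bound C K1 Y S D n q).
Proof.
move=> ni qp ain.
have cd : cont_pos (deriven_within pos q (w n l)).
  exact: deriv_on_cont_pos (@deriven_deriv_on _ _ q (sw n l)).
have ip0 : (0 < i + p)%N by clear -ni; lia.
have nqip : (n + q <= i + p)%N by clear -ni qp; lia.
have S0 : 0 < S by rewrite /S ltr0n.
have nqS : (n + q)%:R <= S by rewrite /S ler_nat.
have [->|a0] := posnP a.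
  rewrite expr0 mul1r.
  apply: (@wnorm_ext _ _ (deriven_within pos q (w n l))).
    by move=> x _; rewrite expr0 mul1r.
  by apply: wnorm_weaken (IH ni q l beta0 betaalpha); [exact: layer_bound_ge0|exact: layer_bound_le].
(* The fraction of [D] by which the weight is shifted. *)
pose k : R := a%:R / (2 * S).
have a0R : 0 < a%:R :> R by rewrite ltr0n.
have aip : (a <= i + p)%N by clear -ain; lia.
have aS : a%:R <= S by rewrite /S ler_nat.
have k0 : 0 < k by rewrite divr_gt0// mulr_gt0.
have k1 : k <= 2^-1 by rewrite ler_pdivrMr ?mulr_gt0//; lra.
have k1' : 0 < 1 - k by lra.
have kD : 0 < k * D by rewrite mulr_gt0.
have bk : beta + k * D < alpha.
  suff : k * D < D by rewrite /D; lra.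
  by rewrite -[ltRHS]mul1r ltr_pM2r//; lra.
have := wnorm_pow a cd kD (IH ni q l (addr_gt0 beta0 kD) bk).
apply: wnorm_weaken.
  by rewrite mulr_ge0 ?exprn_ge0 ?divr_ge0 ?(ltW kD) ?layer_bound_ge0// subr_gt0.
have -> : alpha - (beta + k * D) = (1 - k) * D by rewrite /D; ring.
apply: (@le_trans _ _ ((a%:R / (k * D)) ^+ a * layer_bound C K1 Y S ((1 - k) * D) n q)).
  rewrite ler_wpM2l ?exprn_ge0 ?divr_ge0 ?(ltW kD)//.
  apply: layer_bound_le => //; exact: mulr_gt0.
have -> : a%:R / (k * D) = 2 * (S / D).
  have gen (x y z : R) : x != 0 -> y != 0 -> z != 0 -> x / (x / (2 * y) * z) = 2 * (y / z).
    by move=> x0 y0 z0; field; apply/and3P.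
  by apply: gen; rewrite gt_eqF.
have -> : layer_bound C K1 Y S ((1 - k) * D) n q =
   (1 - k)^-1 ^+ (2 * n + 1 + q) * layer_bound C K1 Y S D n q.
  by rewrite /layer_bound invfM exprMn; ring.
rewrite mulrA ler_wpM2r ?layer_bound_ge0 ?(ltW S0)//.
rewrite -(mulrA Z) (exprMn a 2) (exprMn a Z) mulrAC.
apply: ler_wpM2r; first by rewrite exprn_ge0// divr_ge0 ?(ltW S0) ?(ltW D0).
apply: (@le_trans _ _ (2 ^+ a * expR 2 ^+ a)).
  rewrite ler_wpM2l ?exprn_ge0//.
  by apply: shift_power => //; clear -ni qp; lia.
by rewrite -exprMn; apply: lerXn2r; rewrite ?nnegrE ?(ltW Z0).
Qed.

(** Peel off one factor [x] at a time with [derivenX]. The first term trades it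
for an undifferentiated factor [x]; the second one loses a derivative, which
saves [D / Y] and costs at most [S], and [D <= Z / D] because [D <= alpha].
Hence each factor costs [2 Z S / D]. *)
Lemma wnorm_deriv_pow n l b : forall a q, (n < i)%N -> (q <= p)%N -> (a + b <= i - n)%N ->
  wnorm_le beta (fun x => x ^+ a * deriven_within pos q (fun x => x ^+ b * w n l x) x)
    (2 ^+ b * (Z * S / D) ^+ (a + b) * layer_bound C K1 Y S D n q).
Proof.
have Dal : D < alpha by rewrite /D ltrBlDr ltrDl.
elim: b => [|b IHb] a q ni qp ab.
  rewrite expr0 mul1r addn0.
  apply: wnorm_ext (wnorm_pow_deriv l ni qp (a := a) _) => [x x0|]; last by rewrite addn0 in ab.
  by congr (_ * _); apply: deriven_pos_ext => // z _; rewrite expr0 mul1r.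
have ip0 : (0 < i + p)%N by clear -ni; lia.
have S0 : 0 < S by rewrite /S ltr0n.
have sxb k : smooth_on pos (fun x => x ^+ k * w n l x).
  by apply: smoothM => //; exact: smooth_pow.
have cdb k r c : cont_pos (fun x => x ^+ c * deriven_within pos r (fun x => x ^+ k * w n l x) x).
  apply: cont_posM; first by move=> z z0; exact: exprn_continuous.
  exact: deriv_on_cont_pos (@deriven_deriv_on _ _ r (sxb k)).
have ZSD : 0 < Z * S / D by rewrite divr_gt0// mulr_gt0.
have E x : 0 < x -> x ^+ a * deriven_within pos q (fun x => x ^+ b.+1 * w n l x) x =
   x ^+ a.+1 * deriven_within pos q (fun x => x ^+ b * w n l x) x +
   q%:R * (x ^+ a * deriven_within pos q.-1 (fun x => x ^+ b * w n l x) x).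
  move=> x0; rewrite (@deriven_pos_ext _ q _ (fun x => x * (x ^+ b * w n l x)))//; last first.
    by move=> z _; rewrite exprS mulrA.
  by rewrite derivenX// exprSr; ring.
have B1 := IHb a.+1 q ni qp.
rewrite addSnnS in B1; have {}B1 := B1 ab.
have B0 := layer_bound_gt0 n q S0 D0.
have tgt0 : 0 < 2 ^+ b * (Z * S / D) ^+ (a + b.+1) * layer_bound C K1 Y S D n q.
  by apply: mulr_gt0 => //; apply: mulr_gt0; exact: exprn_gt0.
have -> : 2 ^+ b.+1 * (Z * S / D) ^+ (a + b.+1) * layer_bound C K1 Y S D n q =
  2 ^+ b * (Z * S / D) ^+ (a + b.+1) * layer_bound C K1 Y S D n q +
  2 ^+ b * (Z * S / D) ^+ (a + b.+1) * layer_bound C K1 Y S D n q.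
  by rewrite (exprS 2); ring.
case: q qp E B1 B0 tgt0 => [|q] qp E B1 B0 tgt0.
  apply: wnorm_ext (fun x x0 => esym (E x x0)) _.
  apply: wnorm_ext (_ : forall x, 0 < x -> _ = _) _; last first.
    by apply: wnorm_weaken B1; [exact: ltW|rewrite lerDl ltW].
  by move=> x _ /=; rewrite mul0r addr0.
apply: wnorm_ext (fun x x0 => esym (E x x0)) _.
apply: wnormD => //.
  by apply: cont_posM => //; exact: cont_pos_cst.
have T0 : 0 <= 2 ^+ b * (Z * S / D) ^+ (a + b) * layer_bound C K1 Y S D n q.
  apply: mulr_ge0; last exact: layer_bound_ge0 (ltW S0) D0.
  by apply: mulr_ge0; apply: exprn_ge0 => //; exact: ltW.
have := wnormZ q.+1%:R (cdb b q a) (IHb a q ni (ltnW qp) _).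
rewrite normr_nat => /(_ _)/wnorm_weaken; apply.
- exact: mulr_ge0.
- have -> : layer_bound C K1 Y S D n q.+1 = layer_bound C K1 Y S D n q * (D^-1 * Y).
    by rewrite /layer_bound addnS !exprS; ring.
  rewrite addnS exprS.
  have -> : 2 ^+ b * (Z * S / D * (Z * S / D) ^+ (a + b)) * (layer_bound C K1 Y S D n q * (D^-1 * Y))
    = (Z * S / D * (D^-1 * Y)) * (2 ^+ b * (Z * S / D) ^+ (a + b) * layer_bound C K1 Y S D n q) by ring.
  apply: ler_wpM2r => //.
  apply: (@le_trans _ _ S).
    by rewrite /S ler_nat; clear -qp; lia.
  have DZ : D ^+ 2 <= Z.
    by apply: le_trans Z2; apply: lerXn2r; rewrite ?nnegrE ?ltW.
  have -> : Z * S / D * (D^-1 * Y) = S * (Z / D ^+ 2 * Y) by field; rewrite gt_eqF.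
  rewrite ler_pMr// -[leLHS]mulr1 ler_pM//.
  by rewrite ler_pdivlMr ?exprn_gt0// mul1r.
- by apply: leq_trans ab; rewrite leq_add2l.
Qed.

Variables (Ca gam : R) (K : nat -> 'I_2 -> 'I_2 -> R).
Hypotheses (Ca0 : 0 < Ca) (gam0 : 0 < gam)
  (HK : forall k j l, `|K k j l| <= Ca * gam ^+ k)
  (HK1 : 2 * (2 * Z * gam * alpha) <= K1).

(** The size of the whole forcing relative to the bound for its own order; it
is small when the rate [K1] is large. *)
Definition forcing_ratio := 8 * Ca * Z * gam / K1.

(** The summand with [k = i - n] is, up to the factor [2 Ca], [D^(k-1)] times [(2 Z gam / K1)^k] times the
bound for order [i] with one power of [1 / D] less, so the sum is geometric in
[2 Z gam alpha / K1]. The missing power of [1 / D] is what the energy estimate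
uses. *)
Lemma wnorm_forcing j (u0 : R -> R) (c0 : R) : cont_pos u0 -> 0 < c0 ->
  wnorm_le beta u0 c0 ->
  let F := fun x => u0 x + \sum_(n < i) \sum_l K (i - n) j l *
       deriven_within pos p (fun x => x ^+ (i - n) * w n l x) x in
  cont_pos F /\
  wnorm_le beta F (c0 + C * S ^+ i * D^-1 ^+ (2 * i + p) * K1 ^+ i * Y ^+ p * forcing_ratio).
Proof.
move=> cu0 c00 Hu0 F.
have sxb k n l : smooth_on pos (fun x => x ^+ k * w n l x).
  by apply: smoothM => //; exact: smooth_pow.
pose d n l := deriven_within pos p (fun x => x ^+ (i - n) * w n l x).
have cd n l : cont_pos (d n l).
  exact: deriv_on_cont_pos (@deriven_deriv_on _ _ p (sxb (i - n)%N n l)).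
pose cc n := 2 ^+ (i - n) * (Z * S / D) ^+ (i - n) * layer_bound C K1 Y S D n p.
pose ca n := Ca * gam ^+ (i - n).
have Hd n l : (n < i)%N -> wnorm_le beta (d n l) (cc n).
  move=> ni; have := @wnorm_deriv_pow n l (i - n) 0 p ni (leqnn _).
  rewrite add0n => /(_ (leqnn _)); apply: wnorm_ext => x _.
  by rewrite expr0 mul1r.
have S0 n : (n < i)%N -> 0 < S by move=> ni; rewrite /S ltr0n; clear -ni; lia.
have cc0 n : (n < i)%N -> 0 < cc n.
  move=> ni; have S0' := S0 n ni.
  have ZSD : 0 < Z * S / D by apply: divr_gt0 => //; exact: mulr_gt0.
  apply: mulr_gt0; last exact: layer_bound_gt0.
  by apply: mulr_gt0; exact: exprn_gt0.
have ca0 n : 0 < ca n by rewrite mulr_gt0 ?exprn_gt0.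
have HKd n l : (n < i)%N -> cont_pos (fun x => K (i - n) j l * d n l x) /\
    wnorm_le beta (fun x => K (i - n) j l * d n l x) (ca n * cc n).
  move=> ni; split; first by apply: cont_posM => //; exact: cont_pos_cst.
  apply: wnorm_weaken (wnormZ (K (i - n) j l) (cd n l) (Hd n l ni)).
    by rewrite mulr_ge0// ltW// cc0.
  by rewrite ler_wpM2r ?HK// ltW// cc0.
have Hs n : (n < i)%N -> cont_pos (fun x => \sum_l K (i - n) j l * d n l x) /\
    wnorm_le beta (fun x => \sum_l K (i - n) j l * d n l x) (2 * (ca n * cc n)).
  move=> ni; have [c1 w1] := HKd n 0 ni; have [c2 w2] := HKd n 1 ni.
  have p0 : 0 < ca n * cc n by rewrite mulr_gt0 ?cc0.
  have -> : (fun x => \sum_l K (i - n) j l * d n l x) =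
     (fun x => K (i - n) j 0 * d n 0 x + K (i - n) j 1 * d n 1 x).
    by apply/funext => x; rewrite sum_ord2.
  split; first exact: cont_posD.
  by rewrite mulr_natl mulr2n; exact: wnormD.
have [cF HF] := @wnorm_sum R beta u0 c0 i (fun n x => \sum_l K (i - n) j l * d n l x)
  (fun n => 2 * (ca n * cc n)) cu0 (fun n ni => (Hs n ni).1) c00
  (fun n ni => mulr_gt0 (ltr0Sn R 1) (mulr_gt0 (ca0 n) (cc0 n ni))) Hu0 (fun n ni => (Hs n ni).2).
split => //; apply: wnorm_weaken HF.
  rewrite addr_ge0 ?(ltW c00)// sumr_ge0// => n _.
  by rewrite mulr_ge0// mulr_ge0 ?(ltW (ca0 n))// ltW// cc0.
rewrite lerD2l.
pose rho := 2 * Z * gam * alpha / K1.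
have r0 : 0 <= rho by rewrite divr_ge0 ?mulr_ge0 ?ltW.
have r1 : rho <= 2^-1 by rewrite ler_pdivrMr// ler_pdivlMl.
have Dal : D <= alpha by rewrite /D lerBlDr lerDl ltW.
pose B := C * S ^+ i * D^-1 ^+ (2 * i + p) * K1 ^+ i * Y ^+ p.
have B0 : 0 <= B.
  have := exprn_ge0 i (ler0n R (i + p)); have := exprV_ge0 (2 * i + p) D0.
  have := exprn_ge0 i (ltW K10); have := exprn_ge0 p (ltW Y0) => h1 h2 h3 h4.
  by rewrite /B; do 4 (apply: mulr_ge0 => //); exact: ltW.
apply: (@le_trans _ _ (\sum_(n < i) B * (2 * Ca / alpha) * rho ^+ (i - n))).
  apply: ler_sum => -[n ni] _ /=.
  have S0' := S0 n ni.
  have [k ik] : exists k, (i = n + k.+1)%N by exists (i - n).-1; clear -ni; lia.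
  have ink : (i - n = k.+1)%N by clear -ik; lia.
  have -> : 2 * (ca n * cc n) = (B * (2 * Ca / alpha) * rho ^+ (i - n)) * ((D / alpha) ^+ k).
    rewrite /ca /cc ink /B /layer_bound /rho !exprMn !exprVn.
    have -> : (2 * i + p = (2 * n + 1 + p) + (k + k.+1))%N by clear -ik; lia.
    have -> : S ^+ i = S ^+ n * S ^+ k.+1 by rewrite -exprD -ik.
    have -> : K1 ^+ i = K1 ^+ n * K1 ^+ k.+1 by rewrite -exprD -ik.
    rewrite !exprD !exprS.
    field.
    by rewrite !expf_neq0 ?gt_eqF.
  have : (D / alpha) ^+ k <= 1.
    by rewrite exprn_ile1 ?divr_ge0 ?(ltW D0) ?(ltW alpha0)// ler_pdivrMr// mul1r.
  move=> Hk; apply: ler_piMr => //; apply: mulr_ge0; last exact: exprn_ge0.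
  by apply: mulr_ge0 => //; rewrite divr_ge0 ?(ltW alpha0)// mulr_ge0 ?(ltW Ca0).
rewrite -mulr_sumr -mulrA -/B ler_wpM2l//.
have -> : \sum_(n < i) rho ^+ (i - n) = \sum_(n < i) rho ^+ n.+1.
  rewrite (reindex_inj rev_ord_inj) /=; apply: eq_bigr => n _.
  by congr (_ ^+ _); have := ltn_ord n; clear; lia.
have := geometric_le i r0 r1; set s := \sum_(n < i) _ => Hs'.
apply: (@le_trans _ _ (2 * Ca / alpha * (2 * rho))).
  by rewrite ler_wpM2l// divr_ge0 ?(ltW alpha0)// mulr_ge0 ?(ltW Ca0).
rewrite /forcing_ratio /rho le_eqVlt; apply/orP; left; apply/eqP; field.
by rewrite !gt_eqF.
Qed.

End Recursion.

(** * Constants that close the induction *)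

Section Constants.
Context {R : realType}.
Variables (alpha Ca gam Cu Ku : R).
Hypotheses (al0 : 0 < alpha) (Ca0 : 0 < Ca) (gam0 : 0 < gam) (Cu0 : 0 < Cu) (Ku0 : 0 < Ku).

(** The base [Z] of [wnorm_pow_deriv]. *)
Definition shift_base : R := 2 * expR 2 + alpha ^+ 2.
(** The constant [K1]. It dominates the growth of the boundary values, makes the
geometric ratio of the forcing at most 1/2, and makes [forcing_ratio] small. *)
Definition rate_i : R := Ku * alpha ^+ 2 + 4 * shift_base * gam * alpha + 32 * Ca * shift_base * gam / alpha + 1.
(** A bound for the weighted norm of [exp (- 2 alpha x)]: its square exceeds
[1 / (2 alpha)]. *)
Definition lift_norm : R := 1 + alpha^-1.
Definition lift_cost0 : R := (2 / alpha * (2 * Ca + 4 * alpha ^+ 2) + alpha) * lift_norm.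
Definition lift_cost1 : R := (2 * Ca + 6 * alpha ^+ 2) * lift_norm.
Definition layer_const : R := 1 + 2 * (Cu * lift_cost0).
(** The constant [K2]. *)
Definition rate_m : R := 1 + alpha ^+ 2 + alpha * (Cu * lift_cost1) + 2 * Ca * alpha ^+ 2 + alpha ^+ 4.
Let eta := forcing_ratio rate_i shift_base Ca gam.

Lemma shift_base_gt0 : 0 < shift_base.
Proof. by rewrite /shift_base addr_gt0 ?exprn_gt0// mulr_gt0 ?expR_gt0. Qed.

Lemma rate_i_terms : [/\ 0 < Ku * alpha ^+ 2, 0 < 4 * shift_base * gam * alpha &
  0 < 32 * Ca * shift_base * gam / alpha].
Proof.
have Z0 := shift_base_gt0; split; first by rewrite mulr_gt0 ?exprn_gt0.
  by rewrite mulr_gt0// mulr_gt0// mulr_gt0.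
by rewrite divr_gt0// mulr_gt0// mulr_gt0// mulr_gt0.
Qed.

Lemma rate_i_gt0 : 0 < rate_i.
Proof. by rewrite /rate_i; have [] := rate_i_terms; lra. Qed.

Lemma lift_norm_ge1 : 1 <= lift_norm.
Proof. by rewrite /lift_norm lerDl invr_ge0 ltW. Qed.

Lemma lift_cost0_gt0 : 0 < lift_cost0.
Proof.
have a2 := exprn_gt0 2 al0.
rewrite mulr_gt0//; last by apply: lt_le_trans lift_norm_ge1.
apply: addr_gt0 => //; apply: mulr_gt0; first by rewrite divr_gt0.
have := Ca0; lra.
Qed.

Lemma lift_cost1_gt0 : 0 < lift_cost1.
Proof.
have a2 := exprn_gt0 2 al0.
rewrite mulr_gt0//; last by apply: lt_le_trans lift_norm_ge1.
have := Ca0; lra.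
Qed.

Lemma layer_const_ge1 : 1 <= layer_const.
Proof. by rewrite /layer_const lerDl mulr_ge0// mulr_ge0 ?ltW// lift_cost0_gt0. Qed.

Lemma rate_m_ge1 : 1 <= rate_m.
Proof.
have := exprn_gt0 2 al0; have := exprn_gt0 4 al0; have := mulr_gt0 al0 (mulr_gt0 Cu0 lift_cost1_gt0).
have := mulr_gt0 Ca0 (exprn_gt0 2 al0); rewrite /rate_m; lra.
Qed.

Lemma rate_i_rho : 2 * (2 * shift_base * gam * alpha) <= rate_i.
Proof. by rewrite /rate_i; have [] := rate_i_terms; lra. Qed.

Lemma rate_i_Ku : Ku * alpha ^+ 2 <= rate_i.
Proof. by rewrite /rate_i; have [] := rate_i_terms; lra. Qed.

(** With this the forcing accounts for at most half of the bound in [value_closes]. *)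
Lemma forcing_ratio_le : eta <= alpha / 4.
Proof.
rewrite /eta /forcing_ratio ler_pdivrMr ?rate_i_gt0//.
have [h1 h2 h3] := rate_i_terms.
apply: (@le_trans _ _ (alpha / 4 * (32 * Ca * shift_base * gam / alpha))).
  by rewrite le_eqVlt; apply/orP; left; apply/eqP; field; rewrite gt_eqF.
by rewrite ler_wpM2l ?divr_ge0 ?(ltW al0)// /rate_i; lra.
Qed.

Lemma forcing_ratio_ge0 : 0 <= eta.
Proof.
rewrite /eta /forcing_ratio; apply: divr_ge0; last exact: ltW rate_i_gt0.
apply: mulr_ge0; last exact: ltW.
by apply: mulr_ge0; [apply: mulr_ge0 => //; exact: ltW|exact: ltW shift_base_gt0].
Qed.

Lemma natr_selfpow_gt0 (k : nat) : 0 < k%:R ^+ k :> R.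
Proof. by case: k => [|k]; rewrite ?expr0// exprn_gt0 ?ltr0n. Qed.

Section Step.
Variables (D nu : R) (i : nat).
Hypotheses (D0 : 0 < D) (Dal : D < alpha) (nu0 : 0 < nu) (nu1 : nu <= 1).

Let Y := rate_m / nu.
Let s : R := i%:R.
(** The bound for the boundary value of order [i]. *)
Definition outer_size : R := Cu * Ku ^+ i * s ^+ i.
Let u := outer_size.
Let P : R := D^-1 ^+ (2 * i) * s ^+ i * rate_i ^+ i.

Lemma outer_size_gt0 : 0 < u.
Proof.
by rewrite /u /outer_size mulr_gt0 ?natr_selfpow_gt0// mulr_gt0 ?exprn_gt0.
Qed.

Lemma profile_ge0 : 0 <= P.
Proof.
have h1 := exprV_ge0 (2 * i) D0.
have h2 := exprn_ge0 i (ltW rate_i_gt0); have h3 := exprn_ge0 i (ler0n R i).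
by apply: mulr_ge0 => //; exact: mulr_ge0.
Qed.

(** The boundary values grow no faster than the bound of the theorem, because
[Ku <= K1 / alpha^2 <= K1 / D^2]. *)
Lemma outer_size_le : u <= Cu * P.
Proof.
rewrite /u /outer_size /P -mulrA ler_wpM2l ?(ltW Cu0)//.
rewrite [X in _ <= X]mulrAC ler_wpM2r ?exprn_ge0 ?ler0n//.
rewrite exprM -exprMn; apply: lerXn2r; rewrite ?nnegrE ?(ltW Ku0)//.
  by rewrite mulr_ge0 ?exprn_ge0 ?invr_ge0 ?(ltW D0) ?(ltW rate_i_gt0).
rewrite exprVn ler_pdivlMl ?exprn_gt0//; apply: le_trans rate_i_Ku.
rewrite mulrC ler_wpM2l ?(ltW Ku0)//.
by apply: lerXn2r; rewrite ?nnegrE ?(ltW D0) ?(ltW al0) ?(ltW Dal).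
Qed.

(** The norm of the right hand side once the boundary value has been lifted. *)
Definition energy_rhs : R := (2 * Ca + 4 * alpha ^+ 2) * u * lift_norm +
  layer_const * (i + 0)%:R ^+ i * D^-1 ^+ (2 * i + 0) * rate_i ^+ i * Y ^+ 0 * eta.

Lemma energy_rhsE : energy_rhs = (2 * Ca + 4 * alpha ^+ 2) * u * lift_norm + layer_const * P * eta.
Proof. by rewrite /energy_rhs !addn0 expr0 mulr1 /P /s; ring. Qed.

Lemma forcing_part_le : layer_const * P * eta <= layer_const * P * (alpha / 4).
Proof.
apply: ler_wpM2l forcing_ratio_le; apply: mulr_ge0 profile_ge0.
by apply: le_trans layer_const_ge1.
Qed.

Lemma energy_rhs_gt0 : 0 < energy_rhs.
Proof.
rewrite energy_rhsE ltr_pwDl//.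
  rewrite mulr_gt0//; last exact: lt_le_trans lift_norm_ge1.
  rewrite mulr_gt0 ?outer_size_gt0//.
  have := exprn_gt0 2 al0; have := Ca0; lra.
apply: mulr_ge0 forcing_ratio_ge0; apply: mulr_ge0 profile_ge0.
by apply: le_trans layer_const_ge1.
Qed.

(** The energy estimate for the function itself closes the induction: the
forcing contributes at most half of the bound by [forcing_ratio_le], the
boundary value at most the other half by the choice of [layer_const]. *)
Lemma value_closes : 2 / alpha * D^-1 * energy_rhs + u * lift_norm <= layer_bound layer_const rate_i Y (i + 0)%:R D i 0.
Proof.
rewrite energy_rhsE.
have -> : layer_bound layer_const rate_i Y (i + 0)%:R D i 0 = D^-1 * (layer_const * P).
  by rewrite /layer_bound !addn0 expr0 mulr1 /P /s addn1 exprS; ring.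
have -> : 2 / alpha * D^-1 * ((2 * Ca + 4 * alpha ^+ 2) * u * lift_norm + layer_const * P * eta) + u * lift_norm
  = D^-1 * (2 / alpha * (2 * Ca + 4 * alpha ^+ 2) * lift_norm * u + D * lift_norm * u + 2 / alpha * (layer_const * P * eta)).
  by field; rewrite !gt_eqF.
rewrite ler_wpM2l ?invr_ge0 ?(ltW D0)//.
have h1 : D * lift_norm * u <= alpha * lift_norm * u.
  rewrite ler_wpM2r ?(ltW outer_size_gt0)// ler_wpM2r ?(ltW Dal)//.
  by apply: le_trans lift_norm_ge1.
have h2 : 2 / alpha * (layer_const * P * eta) <= layer_const * P / 2.
  apply: (@le_trans _ _ (2 / alpha * (layer_const * P * (alpha / 4)))).
    by rewrite ler_wpM2l ?forcing_part_le// divr_ge0 ?(ltW al0).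
  by rewrite le_eqVlt; apply/orP; left; apply/eqP; field; rewrite gt_eqF.
have h3 : lift_cost0 * u <= layer_const * P / 2.
  apply: (@le_trans _ _ (lift_cost0 * (Cu * P))).
    by rewrite ler_wpM2l ?outer_size_le// (ltW lift_cost0_gt0).
  have -> : lift_cost0 * (Cu * P) = (Cu * lift_cost0) * P by ring.
  have := profile_ge0; rewrite /layer_const; lra.
have h4 : lift_cost0 * u = 2 / alpha * (2 * Ca + 4 * alpha ^+ 2) * lift_norm * u + alpha * lift_norm * u.
  by rewrite /lift_cost0; ring.
move: h1 h2 h3 h4.
move: (D * lift_norm * u) (alpha * lift_norm * u) (2 / alpha * (layer_const * P * eta)) (layer_const * P) (lift_cost0 * u)
  (2 / alpha * (2 * Ca + 4 * alpha ^+ 2) * lift_norm * u) => x1 x2 x3 x4 x5 x6; lra.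
Qed.

(** The first derivative gains one power of [1 / D] in the bound, and the
remaining constants are absorbed by [K2]. *)
Lemma slope_closes : nu^-1 * (D^-1 * energy_rhs) + 2 * alpha * u * lift_norm <=
  layer_bound layer_const rate_i Y (i + 1)%:R D i 1.
Proof.
rewrite energy_rhsE.
have ND : 0 <= nu^-1 * D^-1 by rewrite mulr_ge0 ?invr_ge0 ?ltW.
apply: (@le_trans _ _ (nu^-1 * D^-1 * (D^-1 * (layer_const * P * rate_m)))); last first.
  have -> : layer_bound layer_const rate_i Y (i + 1)%:R D i 1 =
    nu^-1 * D^-1 * (D^-1 * (layer_const * (D^-1 ^+ (2 * i) * (i + 1)%:R ^+ i * rate_i ^+ i) * rate_m)).
    by rewrite /layer_bound /Y -addnA exprD (_ : 1 + 1 = 2)%N// expr1 expr2; ring.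
  apply: ler_wpM2l => //; apply: ler_wpM2l; first by rewrite invr_ge0 ltW.
  apply: ler_wpM2r; first by apply: le_trans rate_m_ge1.
  apply: ler_wpM2l; first by apply: le_trans layer_const_ge1.
  rewrite /P; apply: ler_wpM2r; first by rewrite exprn_ge0 ?(ltW rate_i_gt0).
  apply: ler_wpM2l; first by rewrite exprn_ge0// invr_ge0 ltW.
  by apply: lerXn2r; rewrite ?nnegrE ?ler0n// ler_nat leq_addr.
have u0 := outer_size_gt0.
have p0 : 0 < lift_norm by apply: lt_le_trans lift_norm_ge1.
have h0 : 2 * alpha * u * lift_norm <= nu^-1 * D^-1 * (2 * alpha ^+ 2 * u * lift_norm).
  have -> : nu^-1 * D^-1 * (2 * alpha ^+ 2 * u * lift_norm) = (alpha / D) * (2 * alpha * u * lift_norm) / nu.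
    by field; rewrite !gt_eqF.
  have X0 : 0 <= 2 * alpha * u * lift_norm by rewrite mulr_ge0 ?(ltW p0)// mulr_ge0 ?(ltW u0)// mulr_ge0 ?(ltW al0).
  rewrite ler_pdivlMr//.
  apply: (@le_trans _ _ (2 * alpha * u * lift_norm)); first by rewrite ler_piMr.
  by rewrite ler_peMl// ler_pdivlMr// mul1r ltW.
apply: (@le_trans _ _ (nu^-1 * D^-1 * (((2 * Ca + 4 * alpha ^+ 2) * u * lift_norm + layer_const * P * eta)
   + 2 * alpha ^+ 2 * u * lift_norm))).
  by rewrite [X in _ <= X]mulrDr mulrA lerD2l.
apply: ler_wpM2l => //.
have h1 : lift_cost1 * u <= Cu * lift_cost1 * P.
  have -> : Cu * lift_cost1 * P = lift_cost1 * (Cu * P) by ring.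
  by rewrite ler_wpM2l ?outer_size_le// (ltW lift_cost1_gt0).
have h2 := forcing_part_le.
have h3 : alpha * (Cu * lift_cost1 * P + layer_const * P * (alpha / 4)) <= layer_const * P * rate_m.
  have a1 : 0 <= (layer_const - 1) * (alpha * (Cu * lift_cost1) * P).
    apply: mulr_ge0; first by rewrite subr_ge0 layer_const_ge1.
    by apply: mulr_ge0 profile_ge0; rewrite mulr_ge0 ?(ltW al0)// mulr_ge0 ?(ltW Cu0) ?(ltW lift_cost1_gt0).
  have a2 : 0 <= layer_const * P * (1 + alpha ^+ 2 * (3 / 4) + 2 * Ca * alpha ^+ 2 + alpha ^+ 4).
    apply: mulr_ge0; first by apply: mulr_ge0 profile_ge0; apply: le_trans layer_const_ge1.
    have := exprn_gt0 2 al0; have := exprn_gt0 4 al0; have := mulr_gt0 Ca0 (exprn_gt0 2 al0); lra.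
  rewrite -subr_ge0.
  have -> : layer_const * P * rate_m - alpha * (Cu * lift_cost1 * P + layer_const * P * (alpha / 4)) =
    (layer_const - 1) * (alpha * (Cu * lift_cost1) * P) +
    layer_const * P * (1 + alpha ^+ 2 * (3 / 4) + 2 * Ca * alpha ^+ 2 + alpha ^+ 4).
    by rewrite /rate_m; field.
  exact: addr_ge0.
rewrite ler_pdivlMl//.
apply: le_trans h3.
apply: ler_pM => //; [exact: ltW| |exact: ltW|].
  rewrite addr_ge0//; last by rewrite mulr_ge0 ?(ltW p0)// mulr_ge0 ?(ltW u0)// mulr_ge0 ?exprn_ge0 ?(ltW al0).
  rewrite -energy_rhsE; exact: ltW energy_rhs_gt0.
have -> : (2 * Ca + 4 * alpha ^+ 2) * u * lift_norm + layer_const * P * eta + 2 * alpha ^+ 2 * u * lift_norm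
  = lift_cost1 * u + layer_const * P * eta by rewrite /lift_cost1; ring.
exact: lerD.
Qed.

(** Two derivatives multiply the bound by [(K2 / (nu D))^2], which is more than
the factor [nu^(-2)] from [E^-1] once [K2] is large. *)
Lemma higher_closes p : nu^-1 ^+ 2 * (2 * Ca * layer_bound layer_const rate_i Y (i + p)%:R D i p +
    layer_const * (i + p)%:R ^+ i * D^-1 ^+ (2 * i + p) * rate_i ^+ i * Y ^+ p * eta) <=
  layer_bound layer_const rate_i Y (i + p.+2)%:R D i p.+2.
Proof.
have Y0 : 0 < Y by rewrite /Y divr_gt0//; apply: lt_le_trans rate_m_ge1.
pose Q : R := layer_const * D^-1 ^+ (2 * i + p) * (i + p)%:R ^+ i * rate_i ^+ i * Y ^+ p.
have C0 : 0 <= layer_const by apply: le_trans layer_const_ge1.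
have h1 := exprV_ge0 (2 * i + p) D0.
have h2 := exprn_ge0 i (ltW rate_i_gt0); have h3 := exprn_ge0 p (ltW Y0).
have Q0 : 0 <= Q.
  by rewrite /Q; apply: mulr_ge0 => //; apply: mulr_ge0 => //; apply: mulr_ge0;
    [exact: mulr_ge0|exact: exprn_ge0].
apply: (@le_trans _ _ (layer_bound layer_const rate_i Y (i + p)%:R D i p.+2)); last first.
  rewrite /layer_bound; apply: ler_wpM2r; first by rewrite exprn_ge0 ?(ltW Y0).
  apply: ler_wpM2r => //; apply: ler_wpM2l.
    by apply: mulr_ge0 => //; rewrite exprn_ge0// invr_ge0 ltW.
  by apply: lerXn2r; rewrite ?nnegrE ?ler0n// ler_nat leq_add2l -addn2 leq_addr.
have -> : layer_bound layer_const rate_i Y (i + p)%:R D i p.+2 = nu^-1 ^+ 2 * (Q * (D^-1 ^+ 3 * rate_m ^+ 2)).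
  rewrite /layer_bound /Q (_ : 2 * i + 1 + p.+2 = 2 * i + p + 3)%N; last by clear; lia.
  by rewrite exprD -(addn2 p) (exprD Y p 2) {2}/Y expr_div_n -exprVn; ring.
have -> : 2 * Ca * layer_bound layer_const rate_i Y (i + p)%:R D i p +
    layer_const * (i + p)%:R ^+ i * D^-1 ^+ (2 * i + p) * rate_i ^+ i * Y ^+ p * eta
  = Q * (2 * Ca * D^-1 + eta).
  rewrite /layer_bound /Q (_ : 2 * i + 1 + p = (2 * i + p).+1)%N; last by clear; lia.
  by rewrite exprS; ring.
apply: ler_wpM2l; first by rewrite exprn_ge0// invr_ge0 ltW.
apply: ler_wpM2l => //.
rewrite exprVn ler_pdivlMl ?exprn_gt0//.
have -> : D ^+ 3 * (2 * Ca * D^-1 + eta) = 2 * Ca * D ^+ 2 + D ^+ 3 * eta.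
  by field; rewrite gt_eqF.
have k1 := rate_m_ge1.
apply: (@le_trans _ _ rate_m); last by rewrite expr2 ler_peMl// (le_trans _ k1).
have DX n : D ^+ n <= alpha ^+ n.
  by apply: lerXn2r; rewrite ?nnegrE ?(ltW D0) ?(ltW al0) ?(ltW Dal).
have b1 : 2 * Ca * D ^+ 2 <= 2 * Ca * alpha ^+ 2.
  by rewrite ler_wpM2l ?DX// mulr_ge0 ?(ltW Ca0).
have b2 : D ^+ 3 * eta <= alpha ^+ 3 * (alpha / 4).
  by apply: ler_pM; rewrite ?DX ?forcing_ratio_le ?forcing_ratio_ge0 ?exprn_ge0 ?(ltW D0).
have b3 : alpha ^+ 3 * (alpha / 4) = alpha ^+ 4 / 4 by field.
have := exprn_gt0 2 al0; have := exprn_gt0 4 al0; have := mulr_gt0 al0 (mulr_gt0 Cu0 lift_cost1_gt0).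
have := mulr_gt0 Ca0 (exprn_gt0 2 al0); rewrite /rate_m; lra.
Qed.

End Step.
End Constants.

(** * Induction on the order of the inner function *)

Section Lifting.
Context {R : realType}.
Implicit Types (x y b : R) (u v : R -> R).

Lemma cont_pos_ext u v : (forall x, 0 < x -> u x = v x) -> cont_pos u -> cont_pos v.
Proof.
move=> uv cu x x0; have H : u y @[y --> x] --> u x := cu x x0.
suff : v y @[y --> x] --> v x by [].
rewrite -uv//; apply: cvg_trans H; apply: near_eq_cvg; near=> y; rewrite uv//; near: y; exact: nbhs_pos.
Unshelve. all: by end_near. Qed.

Variable alpha : R.
Hypothesis al0 : 0 < alpha.

(** It decays faster than every admissible weight grows, uniformly in [beta]. *)
Definition layer_lift x : R := expR (- (2 * alpha) * x).

Lemma deriv_on_layer_lift : deriv_on pos layer_lift (fun x => - (2 * alpha) * layer_lift x).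
Proof. exact: deriv_on_expR. Qed.

Lemma cvg_layer_lift0 : layer_lift x @[x --> 0^'+] --> (1 : R).
Proof.
have : layer_lift x @[x --> (0 : R)] --> layer_lift 0.
  apply: (@continuous_comp _ _ _ (fun x => - (2 * alpha) * x) expR); last exact: continuous_expR.
  exact: mulrl_continuous.
rewrite {2}/layer_lift mulr0 expR0; exact: cvg_at_right_filter.
Qed.

Lemma cvg_layer_liftoo : layer_lift x @[x --> +oo] --> (0 : R).
Proof.
have H : 2 * alpha * x @[x --> +oo] --> (+oo : set_system R).
  by apply: gt0_cvgMry; [rewrite mulr_gt0|exact: cvg_id].
have := cvg_comp _ _ H (@cvgr_expR R).
by apply: cvg_trans; apply: near_eq_cvg; apply: nearW => x; rewrite /layer_lift /= mulNr.
Qed.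

Lemma wnorm_layer_lift beta : 0 < beta -> beta < alpha -> wnorm_le beta layer_lift (lift_norm alpha).
Proof.
move=> b0 ba.
have a20 : 0 < 2 * alpha by rewrite mulr_gt0.
rewrite /wnorm_le -[(lift_norm alpha ^+ 2)%:E]adde0.
pose k (x : R) : R := 0.
apply: le_trans (_ : ((lift_norm alpha ^+ 2 + 0)%:E <= _)%E); last by rewrite adde0 addr0.
have dG : deriv_on pos (fun x => - (2 * alpha)^-1 * layer_lift x) layer_lift.
  apply: deriv_on_ext (deriv_onZ (c := - (2 * alpha)^-1) deriv_on_layer_lift) => // x _.
  by rewrite mulrA mulrNN mulVf ?mul1r// gt_eqF.
have l0 x : 0 < layer_lift x by exact: expR_gt0.
apply: (@int_pos_le_primitive _ _ k _ _ _ _ _ _ _ dG).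
- apply: cont_pos_weight; exact: cont_pos_expR.
- exact: cont_pos_cst.
- exact: cont_pos_expR.
- by move=> x _; exact: weight_ge0.
- by [].
- move=> x x0; rewrite /k addr0 /layer_lift -expRM_natl -expRD ler_expR.
  rewrite -subr_ge0.
  have -> : - (2 * alpha) * x - (2 * beta * x + 2%:R * (- (2 * alpha) * x)) = 2 * ((alpha - beta) * x) by ring.
  by rewrite mulr_ge0// mulr_ge0 ?(ltW x0)// subr_ge0 ltW.
- move=> a0 b1 a00; exists (a0 / 2), (`|b1| + a0); split.
  + by rewrite divr_gt0.
  + by rewrite ltr_pdivrMr// ltr_pMr// ltr1n.
  + by rewrite (le_lt_trans (ler_norm b1))// ltrDl.
  rewrite /= !mulNr opprK addrC; apply: (@le_trans _ _ ((2 * alpha)^-1 * layer_lift (a0 / 2))).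
    rewrite gerBl mulr_ge0 ?invr_ge0 ?(ltW a20)//; exact: ltW.
  apply: (@le_trans _ _ ((2 * alpha)^-1 * 1)).
    rewrite ler_wpM2l ?invr_ge0 ?(ltW a20)// -expR0 ler_expR mulNr oppr_le0.
    by rewrite mulr_ge0 ?(ltW a20)// divr_ge0// ltW.
  rewrite mulr1 invfM /lift_norm.
  have : 0 < alpha^-1 by rewrite invr_gt0.
  move: alpha^-1 => t t0; nra.
- rewrite /int_pos /k.
  by rewrite integral0.
Qed.

End Lifting.

Section Main.
Context {R : realType}.
Variables (alpha Ca gam Cu Ku nu : R) (A : R -> 'M[R]_2) (U W : nat -> R -> 'cV[R]_2).
Hypotheses (al0 : 0 < alpha) (Ca0 : 0 < Ca) (gam0 : 0 < gam) (Cu0 : 0 < Cu) (Ku0 : 0 < Ku)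
  (nu0 : 0 < nu) (nu1 : nu <= 1)
  (Hco : coercive2 alpha (fun j l => A 0 j l))
  (HA0 : forall j l, `|A 0 j l| <= Ca)
  (HA : forall k j l, `|Acoef A k j l| <= Ca * gam ^+ k)
  (HU : forall i j, `|U i 0 j 0| <= outer_size Cu Ku i)
  (HW : is_inner nu A U W).

Let C := layer_const alpha Ca Cu.
Let K1 := rate_i alpha Ca gam Ku.
Let Z := shift_base alpha.
Let Y := rate_m alpha Ca Cu / nu.
Let w := inner_entry W.
Let phi := layer_lift alpha.

Let C0 : 0 < C. Proof. exact: lt_le_trans (layer_const_ge1 al0 Ca0 Cu0). Qed.
Let K10 : 0 < K1. Proof. exact: rate_i_gt0. Qed.
Let Y1 : 1 <= Y.
Proof. by rewrite /Y ler_pdivlMr// mul1r (le_trans nu1)// rate_m_ge1. Qed.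
Let Z1 : 2 * expR 2 <= Z. Proof. by rewrite /Z /shift_base lerDl sqr_ge0. Qed.
Let Z2 : alpha ^+ 2 <= Z.
Proof. by rewrite /Z /shift_base lerDr mulr_ge0 ?expR_ge0. Qed.
Let Y0 : 0 < Y. Proof. exact: lt_le_trans Y1. Qed.
Let sw n l : smooth_on pos (w n l). Proof. exact: (smooth_inner nu0 HW). Qed.

(** The induction hypothesis on the order. *)
Let bound_below i := forall n, (n < i)%N -> forall (beta : R) m l, 0 < beta -> beta < alpha ->
  wnorm_le beta (deriven_within pos m (w n l))
    (layer_bound C K1 Y (n + m)%:R (alpha - beta) n m).

(** Apply the energy estimate to the inner function with its boundary value
lifted; the lifting adds a multiple of [layer_lift] to the forcing. *)
Lemma energy_step i (beta : R) j : bound_below i -> 0 < beta -> beta < alpha ->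
  wnorm_le beta (inner_deriv W i 0 j) (layer_bound C K1 Y (i + 0)%:R (alpha - beta) i 0) /\
  wnorm_le beta (inner_deriv W i 1 j) (layer_bound C K1 Y (i + 1)%:R (alpha - beta) i 1).
Proof.
move=> IH b0 ba.
have D0 : 0 < alpha - beta by rewrite subr_gt0.
have Dal : alpha - beta < alpha by rewrite ltrBlDr ltrDl.
pose u := outer_size Cu Ku i.
have u0 : 0 < u by exact: outer_size_gt0.
pose Phi := lift_norm alpha.
have Phi0 : 0 < Phi by apply: lt_le_trans (lift_norm_ge1 al0).
pose Uj j := U i 0 j 0.
(* The lifting [Uj * phi] changes the right hand side by [q * phi]. *)
pose q j := \sum_l A 0 j l * Uj l - Emx_entry nu j * (4 * alpha ^+ 2 * Uj j).
have a20 : 0 < alpha ^+ 2 by exact: exprn_gt0.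
have qle k : `|q k| <= (2 * Ca + 4 * alpha ^+ 2) * u.
  have A1 l : `|A 0 k l * Uj l| <= Ca * u by rewrite normrM; apply: ler_pM => //; exact: HU.
  have E1 : `|Emx_entry nu k * (4 * alpha ^+ 2 * Uj k)| <= 4 * alpha ^+ 2 * u.
    rewrite normrM (ger0_norm (Emx_entry_ge0 nu k)) normrM (ger0_norm (_ : 0 <= 4 * alpha ^+ 2)); last first.
      by rewrite mulr_ge0// ltW.
    have X0 : 0 <= 4 * alpha ^+ 2 * `|Uj k| by rewrite mulr_ge0// mulr_ge0// ltW.
    apply: le_trans (_ : 4 * alpha ^+ 2 * `|Uj k| <= _).
      by rewrite ler_piMl// (Emx_entry_le1 (ltW nu0) nu1).
    by apply: ler_wpM2l; [rewrite mulr_ge0// ltW|exact: HU].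
  apply: le_trans (ler_normB _ _) _; rewrite sum_ord2.
  have := ler_normD (A 0 k 0 * Uj 0) (A 0 k 1 * Uj 1).
  have := A1 0; have := A1 1; lra.
pose c0 := (2 * Ca + 4 * alpha ^+ 2) * u * Phi.
have c00 : 0 < c0.
  rewrite /c0 mulr_gt0// mulr_gt0//; have := Ca0; lra.
have cphi : cont_pos phi by exact: cont_pos_expR.
pose u0f k x := q k * phi x.
have cu0 k : cont_pos (u0f k) by apply: cont_posM => //; exact: cont_pos_cst.
have wphi : wnorm_le beta phi Phi by exact: wnorm_layer_lift.
have wu0 k : wnorm_le beta (u0f k) c0.
  apply: wnorm_weaken (wnormZ (q k) cphi wphi); first by rewrite mulr_ge0// ltW.
  by rewrite /c0 ler_wpM2r// ltW.
(* The forcing stands on the right hand side, with a minus sign. *)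
pose KK k j l := - Acoef A k j l.
have HKK k j' l : `|KK k j' l| <= Ca * gam ^+ k by rewrite normrN.
have forc k := @wnorm_forcing R alpha C K1 Y Z w i 0 al0 C0 K10 Y1 Z1 Z2 sw IH beta b0 ba
  Ca gam KK Ca0 gam0 HKK (rate_i_rho al0 Ca0 gam0 Ku0) k (u0f k) c0 (cu0 k) c00 (wu0 k).
pose M := energy_rhs alpha Ca gam Cu Ku (alpha - beta) nu i.
have M0 : 0 < M by exact: energy_rhs_gt0.
pose V k x := w i k x + Uj k * phi x.
pose V1 k x := inner_entry1 W i k x + Uj k * (- (2 * alpha) * phi x).
pose V2 k x := inner_entry2 W i k x + Uj k * (- (2 * alpha) * (- (2 * alpha) * phi x)).
have dV k : deriv_on pos (V k) (V1 k).
  apply: deriv_onD; first exact: (deriv_on_inner HW).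
  by apply: (deriv_onZ (c := Uj k)); exact: deriv_on_layer_lift.
have dV1 k : deriv_on pos (V1 k) (V2 k).
  apply: deriv_onD; first exact: (deriv_on_inner1 HW).
  apply: (deriv_onZ (c := Uj k)); apply: (deriv_onZ (c := - (2 * alpha))).
  exact: deriv_on_layer_lift.
have cV2 k : cont_pos (V2 k).
  apply: cont_posD.
    apply: (@cont_pos_ext _ (inner_deriv W i 2 k)); last exact: (cont_inner_deriv nu0 HW).
    by move=> x x0; exact: inner_deriv2 HW _ _ _ x0.
  apply: cont_posM; first exact: cont_pos_cst.
  by do 2 (apply: cont_posM; [exact: cont_pos_cst|]).
have [] := @energy_bound R alpha beta nu M (fun j l => A 0 j l) b0 ba nu0 nu1 Hco V V1 V2 _
  dV dV1 cV2 (fun k => (forc k).1) _ _ _ (fun k => (forc k).2) j.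
- move=> x x0 k; rewrite /=.
  transitivity (- (Emx_entry nu k * inner_entry2 W i k x) + \sum_l A 0 k l * w i l x + u0f k x).
    rewrite /V2 /V /u0f /q !sum_ord2; ring.
  rewrite (inner_eq HW i x0 k) addrC; congr (_ + _).
  rewrite -sumrN; apply: eq_bigr => n _; rewrite -sumrN; apply: eq_bigr => l _.
  by rewrite /KK mulNr.
- move=> k; rewrite /V.
  have [_ W0 WU _] := HW i.
  have : w i k x + Uj k * phi x @[x --> 0^'+] --> W i 0 k 0 + Uj k * 1.
    apply: cvgD; first exact: ((cvg_mxP _ _ _).1 W0 k 0).
    by apply: cvgM; [exact: cvg_cst|exact: cvg_layer_lift0].
  by rewrite WU mxE mulr1 addNr.
- move=> k; rewrite /V.
  have [_ _ _ Woo] := HW i.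
  have : w i k x + Uj k * phi x @[x --> +oo] --> (0 : 'cV[R]_2) k 0 + Uj k * 0.
    apply: cvgD; first exact: ((cvg_mxP _ _ _).1 Woo k 0).
    by apply: cvgM; [exact: cvg_cst|exact: cvg_layer_liftoo].
  by rewrite mxE mulr0 addr0.
move=> BV BV1.
have iD0 : 0 < (alpha - beta)^-1 by rewrite invr_gt0.
have inu0 : 0 < nu^-1 by rewrite invr_gt0.
have cV k : cont_pos (V k) by exact: deriv_on_cont_pos (@dV k).
have cV1 k : cont_pos (V1 k) by exact: deriv_on_cont_pos (@dV1 k).
split.
  apply: wnorm_weaken (value_closes al0 Ca0 gam0 Cu0 Ku0 nu i D0 Dal) _.
    apply: addr_ge0; last by rewrite mulr_ge0 ?ltW.
    by apply: mulr_ge0 (ltW M0); rewrite mulr_ge0 ?(ltW iD0)// divr_ge0// ltW.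
  apply: (@wnorm_ext _ _ (fun x => V j x + (- Uj j) * phi x)).
    by move=> x _; rewrite /V mulNr addrK.
  apply: wnormD => //.
  - by apply: cont_posM => //; exact: cont_pos_cst.
  - by apply: mulr_gt0 => //; apply: mulr_gt0 => //; exact: divr_gt0.
  - exact: mulr_gt0.
  apply: wnorm_weaken (wnormZ (- Uj j) cphi wphi); first by rewrite mulr_ge0// ltW.
  by rewrite normrN ler_wpM2r ?HU// ltW.
apply: wnorm_weaken (slope_closes al0 Ca0 gam0 Cu0 Ku0 i D0 Dal nu0 nu1) _.
  apply: addr_ge0; last by rewrite mulr_ge0 ?(ltW Phi0)// mulr_ge0 ?(ltW u0)// mulr_ge0 ?(ltW al0).
  by apply: mulr_ge0 (ltW inu0) _; apply: mulr_ge0 (ltW iD0) (ltW M0).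
apply: (@wnorm_ext _ _ (fun x => V1 j x + (2 * alpha * Uj j) * phi x)).
  move=> x x0; rewrite (inner_deriv1 HW)// /V1; ring.
apply: wnormD => //.
- by apply: cont_posM => //; exact: cont_pos_cst.
- by apply: mulr_gt0 => //; exact: mulr_gt0.
- by apply: mulr_gt0 => //; apply: mulr_gt0 => //; exact: mulr_gt0.
apply: wnorm_weaken (wnormZ (2 * alpha * Uj j) cphi wphi); first by rewrite mulr_ge0// ltW.
apply: ler_wpM2r; first exact: ltW.
rewrite normrM (ger0_norm (_ : 0 <= 2 * alpha)); last by rewrite mulr_ge0 ?(ltW al0).
by rewrite ler_wpM2l ?HU// mulr_ge0 ?(ltW al0).
Qed.

(** Strong induction on the order, then on the number of derivatives in steps
of two. *)
Lemma inner_bound i : forall (beta : R) m l, 0 < beta -> beta < alpha ->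
  wnorm_le beta (inner_deriv W i m l) (layer_bound C K1 Y (i + m)%:R (alpha - beta) i m).
Proof.
elim/ltn_ind: i => i IH beta m l b0 ba.
have D0 : 0 < alpha - beta by rewrite subr_gt0.
have Dal : alpha - beta < alpha by rewrite ltrBlDr ltrDl.
have hi : bound_below i by move=> n ni b' m' l'; exact: IH.
suff H p : (forall l, wnorm_le beta (inner_deriv W i p l) (layer_bound C K1 Y (i + p)%:R (alpha - beta) i p)) /\
  (forall l, wnorm_le beta (inner_deriv W i p.+1 l) (layer_bound C K1 Y (i + p.+1)%:R (alpha - beta) i p.+1)).
  by case: (H m).
elim: p => [|p [IH0 IH1]].
  by split=> k; have [] := energy_step k hi b0 ba.
split=> // k.
have cd n r : cont_pos (inner_deriv W i n r) by exact: (cont_inner_deriv nu0 HW).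
have B0 : 0 < layer_bound C K1 Y (i + p)%:R (alpha - beta) i p.
  have h1 := exprV_gt0 (2 * i + 1 + p) D0.
  have h2 := exprn_gt0 i K10; have h3 := exprn_gt0 p Y0.
  rewrite /layer_bound; do 2 apply: mulr_gt0 => //; apply: mulr_gt0; first exact: mulr_gt0.
  by case: (i) => [|n]; rewrite ?expr0// exprn_gt0 ?ltr0n.
pose Bp := layer_bound C K1 Y (i + p)%:R (alpha - beta) i p.
have CB0 : 0 < Ca * Bp by exact: mulr_gt0.
have wA r : wnorm_le beta (fun x => A 0 k r * inner_deriv W i p r x) (Ca * Bp).
  apply: wnorm_weaken (wnormZ (A 0 k r) (cd p r) (IH0 r)); first by rewrite mulr_ge0// ltW.
  by rewrite ler_wpM2r// ltW.
have cA r : cont_pos (fun x => A 0 k r * inner_deriv W i p r x).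
  by apply: cont_posM => //; exact: cont_pos_cst.
have [cF wF] := @wnorm_forcing R alpha C K1 Y Z w i p al0 C0 K10 Y1 Z1 Z2 sw hi beta b0 ba
  Ca gam (Acoef A) Ca0 gam0 HA (rate_i_rho al0 Ca0 gam0 Ku0) k
  (fun x => A 0 k 0 * inner_deriv W i p 0 x + A 0 k 1 * inner_deriv W i p 1 x)
  (Ca * Bp + Ca * Bp) (cont_posD (cA 0) (cA 1)) (addr_gt0 CB0 CB0)
  (wnormD (cA 0) (cA 1) CB0 CB0 (wA 0) (wA 1)).
apply: wnorm_weaken (higher_closes al0 Ca0 gam0 Cu0 Ku0 i D0 Dal nu0 p) _.
  apply: mulr_ge0; first by rewrite exprn_ge0// invr_ge0 ltW.
  apply: addr_ge0; first by rewrite mulr_ge0 ?(ltW B0)// mulr_ge0 ?(ltW Ca0).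
  have h1 := exprV_ge0 (2 * i + p) D0.
  have h2 := exprn_ge0 i (ltW K10); have h3 := exprn_ge0 p (ltW Y0).
  apply: mulr_ge0 (forcing_ratio_ge0 al0 Ca0 gam0 Ku0); do 2 apply: mulr_ge0 => //.
  by apply: mulr_ge0 => //; rewrite mulr_ge0 ?(ltW C0) ?exprn_ge0.
have E0 := Emx_entry_gt0 nu0 k.
apply: (wnorm_ext (fun x x0 => esym (inner_derivSS nu0 HW i p k x0))).
apply: wnorm_ext (_ : forall x, 0 < x -> _ = _) _; last first.
  apply: wnorm_weaken (wnormZ (Emx_entry nu k)^-1 cF wF).
    apply: mulr_ge0 => //; apply: addr_ge0; first by rewrite addr_ge0 ?ltW.
    have h1 := exprV_ge0 (2 * i + p) D0.
    have h2 := exprn_ge0 i (ltW K10); have h3 := exprn_ge0 p (ltW Y0).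
    apply: mulr_ge0 (forcing_ratio_ge0 al0 Ca0 gam0 Ku0); do 2 apply: mulr_ge0 => //.
    by apply: mulr_ge0 => //; rewrite mulr_ge0 ?(ltW C0) ?exprn_ge0.
  have -> : 2 * Ca * layer_bound C K1 Y (i + p)%:R (alpha - beta) i p = Ca * Bp + Ca * Bp.
    by rewrite /Bp; ring.
  apply: ler_wpM2r.
    apply: addr_ge0; first by rewrite addr_ge0 ?ltW.
    have h1 := exprV_ge0 (2 * i + p) D0.
    have h2 := exprn_ge0 i (ltW K10); have h3 := exprn_ge0 p (ltW Y0).
    apply: mulr_ge0 (forcing_ratio_ge0 al0 Ca0 gam0 Ku0); do 2 apply: mulr_ge0 => //.
    by apply: mulr_ge0 => //; rewrite mulr_ge0 ?(ltW C0) ?exprn_ge0.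
  rewrite ger0_norm ?invr_ge0 ?(ltW E0)// exprVn lef_pV2 ?posrE ?exprn_gt0//.
  rewrite /Emx_entry; case: ifP => // _; rewrite exprn_ile1// ltW//.
by move=> x x0; rewrite sum_ord2.
Qed.

End Main.

(** * Uniform bounds in the weighted norm *)

(** Back to the norm of the statement: both components are bounded by [B], and
[sqrt 2 <= 2]. *)
Lemma norm0_le (R : realType) (beta B : R) (u : R -> 'cV[R]_2) (v : 'I_2 -> R -> R) :
  0 <= B -> (forall x j, 0 < x -> u x j 0 = v j x) -> (forall j, cont_pos (v j)) ->
  (forall j, wnorm_le beta (v j) B) -> (norm0 beta u <= (2 * B)%:E)%E.
Proof.
move=> B0 uv cv Hv; rewrite /norm0.
have -> : (\int[@lebesgue_measure R]_(x in `]0%R, +oo[)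
      (expR (2 * beta * x) * sqr_euclid (u x))%:E)%E =
  int_pos (fun x => expR (2 * beta * x) * v 0 x ^+ 2 + expR (2 * beta * x) * v 1 x ^+ 2)%R.
  apply: eq_integral => x /set_mem; rewrite mem_halfline => x0.
  by rewrite /sqr_euclid sum_ord2 !uv// mulrDr.
rewrite int_posD; [|exact: cont_pos_weight|exact: cont_pos_weight|
  by move=> x _; exact: weight_ge0|by move=> x _; exact: weight_ge0].
apply: (@le_trans _ _ (((2 * B) ^+ 2)%:E `^ 2^-1)%E).
  apply: gt0_ler_poweR; rewrite ?invr_ge0//.
  - rewrite in_itv /= leey andbT.
    by apply: adde_ge0; apply: integral_ge0 => x _; rewrite lee_fin weight_ge0.
  - by rewrite in_itv /= leey andbT lee_fin sqr_ge0.
  apply: (@le_trans _ _ ((B ^+ 2)%:E + (B ^+ 2)%:E)%E).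
    by apply: leeD; exact: Hv.
  rewrite -EFinD lee_fin; have := sqr_ge0 B; rewrite exprMn; lra.
rewrite poweR_EFin lee_fin powR12_sqrt ?sqr_ge0// sqrtr_sqr ger0_norm//.
by rewrite mulr_ge0.
Qed.

Unset Implicit Arguments.

Theorem theorem6p7 (R : realType) (f g : R -> R) (A : R -> 'M[R]_2)
    (Cf gammaf Cg gammag Ca gammaa alpha : R)
    (hCf : 0 < Cf) (hgammaf : 0 < gammaf)
    (hCg : 0 < Cg) (hgammag : 0 < gammag)
    (hCa : 0 < Ca) (hgammaa : 0 < gammaa)
    (hf : analytic01 Cf gammaf f)
    (hg : analytic01 Cg gammag g)
    (hA : forall i j : 'I_2, analytic01 Ca gammaa (fun x => A x i j))
    (halpha : 0 < alpha)
    (hcoer : forall (xi : 'cV[R]_2) (x : R), 0 <= x <= 1 ->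
       alpha ^+ 2 * (xi^T *m xi) 0 0 <= (xi^T *m A x *m xi) 0 0) :
  exists CU K1 K2 : R,
    [/\ 0 < CU, 0 < K1, 0 < K2 &
      forall eps mu : R, 0 < eps -> eps <= mu -> mu <= 1 ->
      let nu := eps / mu in
      let beta0 := alpha in
      forall U W : nat -> R -> 'cV[R]_2,
        is_outer nu f g A U -> is_inner nu A U W ->
        (forall (i m : nat) (x : R), 0 < x -> derivable (derive1n m (W i)) x 1) /\
        (forall (beta : R) (i m : nat), 0 < beta < beta0 ->
           (norm0 beta (derive1n m (W i)) <=
             (CU * (beta0 - beta) ^- (2 * i + 1 + m)
                 * (i + m)%:R ^+ i * K1 ^+ i * K2 ^+ m * nu ^- m)%:E)%E)].
Proof.
have [Cu [Ku [Cu0 Ku0 HU]]] := outer_at0_bound hCf hgammaf hCg hgammag hCa hgammaa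
  hf hg hA halpha hcoer.
have C1 := layer_const_ge1 halpha hCa Cu0.
have K10 := rate_i_gt0 halpha hCa hgammaa Ku0.
have K21 := rate_m_ge1 halpha hCa Cu0.
exists (2 * layer_const alpha Ca Cu), (rate_i alpha Ca gammaa Ku), (rate_m alpha Ca Cu); split.
- by rewrite mulr_gt0//; exact: lt_le_trans C1.
- exact: K10.
- exact: lt_le_trans K21.
move=> eps mu eps0 epsmu mu1 nu beta0 U W Houter Hinner.
have mu0 : 0 < mu by exact: lt_le_trans epsmu.
have nu0 : 0 < nu by exact: divr_gt0.
have nu1 : nu <= 1 by rewrite ler_pdivrMr// mul1r.
split=> [i m x x0|beta i m /andP[b0 ba]].
  exact: (derive1n_inner nu0 Hinner i m x0).1.
have Hco : coercive2 alpha (fun j l => A 0 j l) by exact: coercive_A hcoer _ I01_0.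
have HA := Acoef_le hA.
have HA0 j l : `|A 0 j l| <= Ca.
  have := HA 0%N j l; rewrite expr0 mulr1 (Acoef_taylor hA) taylor_coef0; exact.
have HU0 k j : `|U k 0 j 0| <= outer_size Cu Ku k.
  by rewrite /outer_size -natrX; exact: (HU nu U (ltW nu0) nu1 Houter).
have D0 : 0 < alpha - beta by rewrite subr_gt0.
have HB j := inner_bound halpha hCa hgammaa Cu0 Ku0 nu0 nu1 Hco HA0 HA HU0 Hinner i m j b0 ba.
have := @norm0_le R beta _ (derive1n m (W i)) (inner_deriv W i m) _ _ _ HB.
rewrite /layer_bound.
have -> : 2 * (layer_const alpha Ca Cu * (alpha - beta)^-1 ^+ (2 * i + 1 + m) * (i + m)%:R ^+ i *
   rate_i alpha Ca gammaa Ku ^+ i * (rate_m alpha Ca Cu / nu) ^+ m) =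
  2 * layer_const alpha Ca Cu * (beta0 - beta) ^- (2 * i + 1 + m) * (i + m)%:R ^+ i *
     rate_i alpha Ca gammaa Ku ^+ i * rate_m alpha Ca Cu ^+ m * nu ^- m.
  by rewrite -!exprVn exprMn /beta0; ring.
apply.
- have h1 := exprV_ge0 (2 * i + 1 + m) D0.
  have h2 := exprn_ge0 i (ltW K10).
  have h3 : 0 <= (rate_m alpha Ca Cu / nu) ^+ m.
    by rewrite exprn_ge0// divr_ge0 ?(ltW nu0)// (le_trans _ K21).
  do 2 apply: mulr_ge0 => //; rewrite mulr_ge0 ?exprn_ge0//.
  by rewrite mulr_ge0// (le_trans _ C1).
- by move=> x j x0; exact: (derive1n_inner nu0 Hinner i m x0).2.
- move=> j; exact: (cont_inner_deriv nu0 Hinner).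
Qed.
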